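(* Let $r$ be a positive natural number. Let the functions $f,g:\Sigma^2\to\mathbb{C}$ be holomorphic on the punctured sphere $\Sigma^2$. Further let $P:\mathbb{R}\to\mathbb{C}$ be a complex-valued polynomial $$P(t)=\sum_{k=0}^{2r-1}b_kt^k$$ such that $(b_{2r-2},b_{2r-1})\neq 0$. Then the function $$F(z,\bar z,t)=(f(z)+g(\bar z))\cdot P(t)$$ is proper $r$-harmonic on the product space $\Sigma^2\times\mathbb{R}$.
   Context: $\Sigma^2=\mathbb{S}^2\setminus\{p\}$ is the punctured round sphere, modelled as the complex plane $\mathbb{C}$ (coordinate $z=x+iy$) with the Riemannian metric $ds^2=\frac{4}{(1+(x^2+y^2))^2}(dx^2+dy^2)$ of constant curvature $+1$; holomorphic functions on $\Sigma^2$ are the holomorphic functions on $\mathbb{C}$. $\Sigma^2\times\mathbb{R}$ carries the product metric with the standard metric $dt^2$ on $\mathbb{R}$. Let $\tau$ be the Laplace-Beltrami operator of this product metric, acting on smooth complex-valued functions. Put $\tau^0(F)=F$ and $\tau^r(F)=\tau(\tau^{r-1}(F))$. For $r\ge1$, a smooth function $F$ is $r$-harmonic if $\tau^r(F)=0$ identically, and proper $r$-harmonic if $\tau^r(F)=0$ and $\tau^{r-1}(F)$ does not vanish identically.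
   Formalization: The formal theorem additionally assumes that f(z)+g(z̄) is not identically zero; without this (for example f = g = 0) the function F vanishes identically, so it is r-harmonic but not proper r-harmonic. *)

(* Defs.v *)
From HB Require Import structures.
From mathcomp Require Import all_boot all_order all_algebra.
From mathcomp Require Import complex.
From mathcomp Require Import boolp classical_sets reals topology normedtype derive.
Set Implicit Arguments.
Unset Strict Implicit.
Unset Printing Implicit Defensive.
Import Order.TTheory GRing.Theory Num.Theory.
Import numFieldNormedType.Exports.
Local Open Scope ring_scope.
Local Open Scope complex_scope.

(* The base [R[i]^o] makes [derivable] use complex increments, so this is
   complex differentiability at every point of the plane. *)
Definition holomorphic (R : realType) (f : R[i] -> R[i]) : Prop :=
  forall z : R[i], derivable (f : R[i]^o -> R[i]^o) z 1.

Definition partial (R : realType) (n : nat) (i : 'I_n) (u : 'rV[R]_n -> R) :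
  'rV[R]_n -> R := fun x => 'D_(delta_mx 0 i) u x.

(* C^oo: all iterated partial derivatives exist and are continuous. *)
Definition smooth (R : realType) (n : nat) (u : 'rV[R]_n -> R) : Prop :=
  forall s : seq 'I_n, let v := foldr (@partial R n) u s in
    continuous v /\ forall (i : 'I_n) x, derivable v x (delta_mx 0 i).

Definition csmooth (R : realType) (n : nat) (F : 'rV[R]_n -> R[i]) : Prop :=
  smooth (fun x => complex.Re (F x)) /\ smooth (fun x => complex.Im (F x)).

(* A metric on R^n is given by its matrix in the standard coordinates. The
   operator is
     |G|^(-1/2) \sum_i d_i (|G|^(1/2) \sum_j G^(ij) d_j u). *)
Definition laplace_beltrami (R : realType) (n : nat) (G : 'rV[R]_n -> 'M[R]_n)
    (u : 'rV[R]_n -> R) : 'rV[R]_n -> R := fun x =>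
  (Num.sqrt (\det (G x)))^-1 *
  \sum_(i < n) partial i (fun y => Num.sqrt (\det (G y)) *
     \sum_(j < n) invmx (G y) i j * partial j u y) x.

Definition tau (R : realType) (n : nat) (G : 'rV[R]_n -> 'M[R]_n)
    (F : 'rV[R]_n -> R[i]) : 'rV[R]_n -> R[i] := fun x =>
  laplace_beltrami G (fun y => complex.Re (F y)) x +i*
  laplace_beltrami G (fun y => complex.Im (F y)) x.

(* Both notions are meant for [0 < r]. *)
Definition r_harmonic (R : realType) (n : nat) (G : 'rV[R]_n -> 'M[R]_n)
    (r : nat) (F : 'rV[R]_n -> R[i]) : Prop :=
  csmooth F /\ forall x, iter r (tau G) F x = 0.

Definition proper_r_harmonic (R : realType) (n : nat)
    (G : 'rV[R]_n -> 'M[R]_n) (r : nat) (F : 'rV[R]_n -> R[i]) : Prop :=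
  r_harmonic G r F /\ ~ (forall x, iter r.-1 (tau G) F x = 0).

Definition product_metric (R : realType) (m n : nat)
    (G : 'rV[R]_m -> 'M[R]_m) (H : 'rV[R]_n -> 'M[R]_n) :
    'rV[R]_(m + n) -> 'M[R]_(m + n) := fun p =>
  block_mx (G (lsubmx p)) 0 0 (H (rsubmx p)).

(* Punctured round sphere, in the stereographic coordinates (x, y). *)
Definition sphere_metric (R : realType) (q : 'rV[R]_2) : 'M[R]_2 :=
  (4 / (1 + (q 0 0 ^+ 2 + q 0 1 ^+ 2)) ^+ 2)%:M.

Definition line_metric (R : realType) (q : 'rV[R]_1) : 'M[R]_1 := 1%:M.

Definition sphere_line_metric (R : realType) :
    'rV[R]_(2 + 1) -> 'M[R]_(2 + 1) :=
  product_metric (@sphere_metric R) (@line_metric R).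

Definition zcoord (R : realType) (p : 'rV[R]_(2 + 1)) : R[i] :=
  (lsubmx p) 0 0 +i* (lsubmx p) 0 1.

Definition tcoord (R : realType) (p : 'rV[R]_(2 + 1)) : R := (rsubmx p) 0 0.

(* Main.v *)
Require Import Defs.
From HB Require Import structures.
From mathcomp Require Import all_boot all_order all_algebra.
From mathcomp Require Import complex.
From mathcomp Require Import boolp classical_sets reals topology normedtype derive.
From mathcomp Require Import zify ring lra.
From mathcomp Require Import ereal measure lebesgue_measure lebesgue_integral ftc.
Set Implicit Arguments.
Unset Strict Implicit.
Unset Printing Implicit Defensive.
Import Order.TTheory GRing.Theory Num.Theory.
Import numFieldNormedType.Exports.
Local Open Scope ring_scope.
Local Open Scope complex_scope.

(* A function that is complex differentiable everywhere has vanishing integral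
   over rectangles, by Goursat's bisection argument. Applied to the difference
   quotient z |-> (f z - f w) / (z - w), this gives Cauchy's formula on the
   square [-1, 1] x [-1, 1] in the form f w * c w = J w, where c and J are the
   integrals of 1 / (z - w) and f z / (z - w) over the boundary. Both can be
   differentiated twice under the integral sign and c 0 != 0, so f' is again
   differentiable at 0, hence everywhere by translation. Integrals of
   continuous functions are increments of primitives throughout.

   Consequently the functions (f z + g (conj z)) * p t, with f and g
   holomorphic and p a polynomial, form a class closed under the three partial
   derivatives, hence consist of smooth functions. The Laplacian of the plane
   kills f z + g (conj z), and a surface metric that is conformal to the plane
   only rescales that Laplacian, so tau turns p into its second derivative. *)

Local Notation nm := Normc.normc.

(** * Complex derivatives and curves in the plane *)

(** Multiplying the difference quotient by [h] makes the estimate meaningful at [h = 0] too. Keeping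
    [K] general serves the real and the complex derivative at once. *)
Lemma is_derive1_littleoP (K : numFieldType) (f : K -> K) (x d : K) :
  is_derive (x : K^o) (1 : K^o) (f : K^o -> K^o) (d : K^o) <->
  forall e : K, 0 < e ->
    exists2 D : K, 0 < D &
      forall h, `|h| < D -> `|f (x + h) - f x - d * h| <= e * `|h|.
Proof.
have eqlim : is_derive (x : K^o) (1 : K^o) (f : K^o -> K^o) (d : K^o) <->
    (h^-1 *: (f (h *: (1 : K^o) + x) - f x) @[h --> (0 : K^o)^'] --> (d : K^o))%classic.
  split=> [[df <-] // | cv].
  split; first by apply/cvg_ex; exists d.
  exact: cvg_lim.
have E h : h != 0 ->
    d - h^-1 * (f (h *: (1 : K^o) + x) - f x) =
    - (h^-1 * (f (x + h) - f x - d * h)).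
  by move=> h0; rewrite /GRing.scale /= mulr1 (addrC x); field.
rewrite eqlim; split=> [/cvgrPdist_le cv e e0 | H].
  have /nbhs_ballP[D /= D0 HD] := cv e e0.
  exists D => // h hD; have [->|h0] := eqVneq h 0.
    by rewrite addr0 subrr mulr0 subrr normr0 mulr0.
  have := HD h; rewrite /ball /= sub0r normrN => /(_ hD h0).
  by rewrite E // normrN normrM normfV mulrC ler_pdivrMr ?normr_gt0.
apply/cvgrPdist_le => e e0; have [D D0 HD] := H e e0.
apply/nbhs_ballP; exists D => //= h; rewrite /ball /= sub0r normrN => hD h0.
by rewrite E // normrN normrM normfV mulrC ler_pdivrMr ?normr_gt0 // HD.
Qed.


Section ComplexNorm.
Variable R : realType.
Implicit Types z w : R[i].

Lemma normcE z : `|z| = (nm z)%:C.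
Proof. by case: z. Qed.

Lemma nm_ge0 z : 0 <= nm z.
Proof. by case: z => a b; exact: sqrtr_ge0. Qed.

Lemma nmD z w : nm (z + w) <= nm z + nm w.
Proof. exact: le_normcD. Qed.

Lemma nmN z : nm (- z) = nm z.
Proof. exact: normcN. Qed.

Lemma nmB z w : nm (z - w) <= nm z + nm w.
Proof. by rewrite -(nmN w) nmD. Qed.

Lemma nmC z w : nm (z - w) = nm (w - z).
Proof. by rewrite -nmN opprB. Qed.

Lemma nm_real (t : R) : nm t%:C = `|t|.
Proof. by rewrite /= expr0n /= addr0 sqrtr_sqr. Qed.

Lemma nm_i : nm 'i = 1 :> R.
Proof. by rewrite /= expr0n /= add0r expr1n sqrtr1. Qed.

Lemma nm_eq0 z : (nm z == 0) = (z == 0).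
Proof.
by apply/eqP/eqP=> [/Normc.eq0_normc // | ->]; rewrite Normc.normc0.
Qed.

Lemma nm_gt0 z : (0 < nm z) = (z != 0).
Proof. by rewrite lt_def nm_ge0 nm_eq0 andbT. Qed.

Lemma ler_Re_nm z : `|complex.Re z| <= nm z.
Proof. by rewrite -lecR -normcE normc_ge_Re. Qed.

Lemma ler_Im_nm z : `|complex.Im z| <= nm z.
Proof.
case: z => a b /=; rewrite -(sqrtr_sqr b); apply: ler_wsqrtr.
by rewrite lerDr sqr_ge0.
Qed.

Lemma nm_le_ReIm z : nm z <= `|complex.Re z| + `|complex.Im z|.
Proof.
rewrite {1}[z]complexE (le_trans (nmD _ _)) // Normc.normcM nm_i mul1r.
by rewrite !nm_real.
Qed.

(** A positive element of [R[i]] is real, so both radii of the complex criterion can be taken in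
    [R]. *)
Lemma is_cderiveP (f : R[i] -> R[i]) (z d : R[i]) :
  is_derive (z : R[i]^o) (1 : R[i]^o) (f : R[i]^o -> R[i]^o) (d : R[i]^o) <->
  forall e : R, 0 < e -> exists2 D : R, 0 < D &
    forall h, nm h < D -> nm (f (z + h) - f z - d * h) <= e * nm h.
Proof.
rewrite is_derive1_littleoP; split=> H e e0.
  have [|D D0 HD] := H e%:C; first by rewrite ltcR.
  have Dr : D = (complex.Re D)%:C by rewrite RRe_real // gtr0_real.
  exists (complex.Re D); first by move: D0; rewrite {1}Dr ltcR.
  move=> h hD; have := HD h; rewrite Dr !normcE ltcR -rmorphM lecR; exact.
have er : e = (complex.Re e)%:C by rewrite RRe_real // gtr0_real.
have [|D D0 HD] := H (complex.Re e); first by move: e0; rewrite {1}er ltcR.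
exists D%:C; first by rewrite ltcR.
by move=> h; rewrite er !normcE ltcR -rmorphM lecR; exact: HD.
Qed.

Lemma is_rderiveP (f : R -> R) (x d : R) :
  is_derive x 1 f d <->
  forall e : R, 0 < e -> exists2 D : R, 0 < D &
    forall h, `|h| < D -> `|f (x + h) - f x - d * h| <= e * `|h|.
Proof. exact: is_derive1_littleoP. Qed.

(** The parameter is real while [R[i]^o] is normed over [R[i]], so the derivative is taken
    componentwise. *)
Definition is_curve_deriv (phi : R -> R[i]) (t : R) (d : R[i]) : Prop :=
  is_derive t 1 (fun s => complex.Re (phi s)) (complex.Re d) /\
  is_derive t 1 (fun s => complex.Im (phi s)) (complex.Im d).

Lemma Re_mulr_real z (t : R) : complex.Re (z * t%:C) = complex.Re z * t.
Proof. by case: z => a b /=; rewrite mulr0 subr0. Qed.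

Lemma Im_mulr_real z (t : R) : complex.Im (z * t%:C) = complex.Im z * t.
Proof. by case: z => a b /=; rewrite mulr0 add0r. Qed.

Lemma is_curve_derivP (phi : R -> R[i]) (t : R) (d : R[i]) :
  is_curve_deriv phi t d <->
  forall e : R, 0 < e -> exists2 D : R, 0 < D &
    forall h, `|h| < D ->
      nm (phi (t + h) - phi t - d * h%:C) <= e * `|h|.
Proof.
split=> [[/is_rderiveP dR /is_rderiveP dI] e e0 | H].
  have e20 : 0 < e / 2 by rewrite divr_gt0.
  have [D1 D10 H1] := dR _ e20; have [D2 D20 H2] := dI _ e20.
  exists (Num.min D1 D2); first by rewrite lt_min D10.
  move=> h; rewrite lt_min => /andP[/H1 h1 /H2 h2].
  apply: le_trans (nm_le_ReIm _) _.
  by rewrite !raddfB /= Re_mulr_real Im_mulr_real; lra.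
split; apply/is_rderiveP => e e0; have [D D0 HD] := H e e0; exists D => // h /HD.
  by apply: le_trans; rewrite -Re_mulr_real -!raddfB ler_Re_nm.
by apply: le_trans; rewrite -Im_mulr_real -!raddfB ler_Im_nm.
Qed.

Lemma is_curve_deriv_comp (f : R[i] -> R[i]) (p u d : R[i]) (t : R) :
  is_derive (p + t%:C * u : R[i]^o) (1 : R[i]^o) (f : R[i]^o -> R[i]^o)
    (d : R[i]^o) ->
  is_curve_deriv (fun s => f (p + s%:C * u)) t (d * u).
Proof.
move=> /is_cderiveP H; apply/is_curve_derivP => e e0.
(* The added 1 keeps the divisor positive when [u = 0]. *)
have k0 : 0 < nm u + 1 by rewrite ltr_wpDl ?nm_ge0.
have [|D D0 HD] := H (e / (nm u + 1)); first by rewrite divr_gt0.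
exists (D / (nm u + 1)); first by rewrite divr_gt0.
move=> h hD; have hu : nm (h%:C * u) <= `|h| * (nm u + 1).
  by rewrite Normc.normcM nm_real ler_wpM2l // lerDl.
have -> : p + (t + h)%:C * u = p + t%:C * u + h%:C * u.
  by rewrite rmorphD /= mulrDl addrA.
have -> : d * u * h%:C = d * (h%:C * u) by rewrite mulrAC mulrA.
apply: le_trans (HD _ _) _.
  by apply: le_lt_trans hu _; rewrite -ltr_pdivlMr.
rewrite mulrAC -mulrA; apply: ler_wpM2l; first exact: ltW.
by rewrite ler_pdivrMr.
Qed.

Lemma is_curve_derivD (phi psi : R -> R[i]) t (d e : R[i]) :
  is_curve_deriv phi t d -> is_curve_deriv psi t e ->
  is_curve_deriv (fun s => phi s + psi s) t (d + e).
Proof.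
move=> [r1 i1] [r2 i2]; split; rewrite raddfD; under eq_fun do rewrite raddfD;
  exact: is_deriveD.
Qed.

Lemma is_curve_derivZ (z : R[i]) (phi : R -> R[i]) t (d : R[i]) :
  is_curve_deriv phi t d -> is_curve_deriv (fun s => z * phi s) t (z * d).
Proof.
move=> /is_curve_derivP H; apply/is_curve_derivP => e e0.
have k0 : 0 < nm z + 1 by rewrite ltr_wpDl ?nm_ge0.
have [|D D0 HD] := H (e / (nm z + 1)); first by rewrite divr_gt0.
exists D => // h /HD hD.
have -> : z * phi (t + h) - z * phi t - z * d * h%:C =
    z * (phi (t + h) - phi t - d * h%:C) by ring.
rewrite Normc.normcM; apply: le_trans (_ : (nm z + 1) * _ <= _).
  by apply: ler_wpM2r; rewrite ?nm_ge0 // lerDl.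
apply: le_trans (ler_wpM2l (ltW k0) hD) _.
by rewrite mulrA mulrCA divff ?gt_eqF // mulr1.
Qed.

Lemma is_curve_derivB (phi psi : R -> R[i]) t (d e : R[i]) :
  is_curve_deriv phi t d -> is_curve_deriv psi t e ->
  is_curve_deriv (fun s => phi s - psi s) t (d - e).
Proof.
move=> h1 /(is_curve_derivZ (-1)) h2; have := is_curve_derivD h1 h2.
by rewrite mulN1r (_ : (fun s => _ + -1 * psi s) = (fun s => phi s - psi s)) //;
  apply/funext => s; rewrite mulN1r.
Qed.

End ComplexNorm.

(** * Primitives *)

Lemma continuous_at_dist_le (K : numFieldType) (T : topologicalType)
    (V : pseudoMetricNormedZmodType K) (f : T -> V) (x : T) :
  (forall e : K, 0 < e -> \forall y \near x, `|f x - f y| <= e) ->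
  {for x, continuous f}.
Proof. by move=> H; apply/cvgrPdist_le. Qed.

Section Prim.
Variable R : realType.

Lemma Re_continuous : continuous (@complex.Re R : R[i]^o -> R).
Proof.
move=> z; apply: continuous_at_dist_le => e e0; apply/nbhs_ballP.
exists e%:C; rewrite /= ?ltcR // => w; rewrite /ball /= normcE ltcR => /ltW.
by apply: le_trans; rewrite -raddfB ler_Re_nm.
Qed.

Lemma Im_continuous : continuous (@complex.Im R : R[i]^o -> R).
Proof.
move=> z; apply: continuous_at_dist_le => e e0; apply/nbhs_ballP.
exists e%:C; rewrite /= ?ltcR // => w; rewrite /ball /= normcE ltcR => /ltW.
by apply: le_trans; rewrite -raddfB ler_Im_nm.
Qed.

Lemma real_complex_continuous : continuous (fun t : R => t%:C : R[i]^o).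
Proof.
move=> t; apply: continuous_at_dist_le => e e0.
have er : e = (complex.Re e)%:C by rewrite RRe_real // gtr0_real.
have e1 : 0 < complex.Re e by move: e0; rewrite {1}er ltcR.
apply/nbhs_ballP; exists (complex.Re e) => // s; rewrite /ball /= => /ltW.
by rewrite -rmorphB normcE nm_real er lecR.
Qed.

Lemma line_continuous (p u : R[i]) :
  continuous (fun t : R => p + t%:C * u : R[i]^o).
Proof.
move=> t; apply: cvgD; first exact: cvg_cst.
by apply: cvgM; [exact: real_complex_continuous | exact: cvg_cst].
Qed.

Lemma real_primitive (h : R -> R) : continuous h ->
  exists H : R -> R, forall t : R, -2 < t < 2 -> is_derive t 1 H (h t).
Proof.
move=> ch.
have ih : (@lebesgue_measure R).-integrable `[-2, 2]%classic (EFin \o h).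
  apply: continuous_compact_integrable; first exact: segment_compact.
  by apply: continuous_subspaceT.
exists (fun x => (\int[@lebesgue_measure R]_(t in [set` `[-2, x]]) h t)%R).
move=> t /andP[t1 t2].
have [dH HE] := continuous_FTC1_closed t2 ih t1 (ch t).
by split; [exact: dH | rewrite -derive1E; exact: HE].
Qed.

(* Primitives are only required on ]-2, 2[: every path below is
   parametrised by [-1, 1]. *)
Definition primitive (phi Phi : R -> R[i]) : Prop :=
  forall t : R, -2 < t < 2 -> is_curve_deriv Phi t (phi t).

Lemma primitive_exists (phi : R -> R[i]) :
  continuous (phi : R -> R[i]^o) -> exists Phi, primitive phi Phi.
Proof.
move=> cphi.
have [|H HH] := @real_primitive (@complex.Re R \o phi).
  move=> t; apply: (@continuous_comp R R[i]^o R phi (@complex.Re R)).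
    exact: cphi.
  exact: Re_continuous.
have [|K KK] := @real_primitive (@complex.Im R \o phi).
  move=> t; apply: (@continuous_comp R R[i]^o R phi (@complex.Im R)).
    exact: cphi.
  exact: Im_continuous.
by exists (fun t => H t +i* K t) => t ht; split => /=; [exact: HH|exact: KK].
Qed.

Lemma primitiveD (phi psi Phi Psi : R -> R[i]) :
  primitive phi Phi -> primitive psi Psi ->
  primitive (fun t => phi t + psi t) (fun t => Phi t + Psi t).
Proof. by move=> h k t ht; exact: is_curve_derivD (h t ht) (k t ht). Qed.

Lemma primitiveB (phi psi Phi Psi : R -> R[i]) :
  primitive phi Phi -> primitive psi Psi ->
  primitive (fun t => phi t - psi t) (fun t => Phi t - Psi t).
Proof. by move=> h k t ht; exact: is_curve_derivB (h t ht) (k t ht). Qed.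

Lemma primitiveZ (z : R[i]) (phi Phi : R -> R[i]) :
  primitive phi Phi -> primitive (fun t => z * phi t) (fun t => z * Phi t).
Proof. by move=> h t ht; exact: is_curve_derivZ (h t ht). Qed.

Lemma primitive_cst (z : R[i]) : primitive (fun=> z) (fun t => z * t%:C).
Proof.
move=> t _; rewrite -[z in is_curve_deriv _ _ z]mulr1.
apply: is_curve_derivZ; split=> /=; first exact: is_derive_id.
exact: is_derive_cst.
Qed.

Lemma real_increment_le (F h : R -> R) (a b M : R) : a <= b ->
  (forall t, a <= t <= b -> is_derive t 1 F (h t)) ->
  (forall t, a <= t <= b -> `|h t| <= M) ->
  `|F b - F a| <= M * (b - a).
Proof.
move=> ab dF hM.
have [t|t|c /[!in_itv]/= cab ->] := @MVT_segment R F h a b ab.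
- by rewrite in_itv /= => /andP[/ltW ? /ltW ?]; apply: dF; apply/andP.
- apply: derivable_within_continuous => s /[!in_itv]/= sab.
  by have [] := dF s sab.
- rewrite normrM (ger0_norm (_ : 0 <= b - a)) ?subr_ge0 //.
  by rewrite ler_wpM2r ?subr_ge0 // hM.
Qed.

(** The mean value theorem is available only for real functions. Applying it to the real and the
    imaginary part of [Phi t - c * t] separately costs the factor 2. *)
Lemma primitive_increment (phi Phi : R -> R[i]) (c : R[i]) (a b M : R) :
  primitive phi Phi -> -2 < a -> b < 2 -> a <= b ->
  (forall t, a <= t <= b -> nm (phi t - c) <= M) ->
  nm (Phi b - Phi a - c * (b - a)%:C) <= 2 * M * (b - a).
Proof.
move=> hP a2 b2 ab hM.
have itv t : a <= t <= b -> -2 < t < 2 by move=> /andP[h1 h2]; lra.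
have := primitiveB hP (primitive_cst c).
set Psi := (fun t => Phi t - _) => hPsi.
have -> : Phi b - Phi a - c * (b - a)%:C = Psi b - Psi a.
  by rewrite /Psi rmorphB /=; ring.
apply: le_trans (nm_le_ReIm _) _.
rewrite (raddfB (@complex.Re R)) (raddfB (@complex.Im R)).
have -> : 2 * M * (b - a) = M * (b - a) + M * (b - a) by ring.
apply: lerD.
- apply: (real_increment_le (F := fun t => complex.Re (Psi t))
    (h := fun t => complex.Re (phi t - c))) => // t ht.
    by have [] := hPsi t (itv t ht).
  exact: le_trans (ler_Re_nm _) (hM t ht).
- apply: (real_increment_le (F := fun t => complex.Im (Psi t))
    (h := fun t => complex.Im (phi t - c))) => // t ht.
    by have [] := hPsi t (itv t ht).
  exact: le_trans (ler_Im_nm _) (hM t ht).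
Qed.

Lemma primitive_increment0 (phi Phi : R -> R[i]) (a b M : R) :
  primitive phi Phi -> -2 < a -> b < 2 -> a <= b ->
  (forall t, a <= t <= b -> nm (phi t) <= M) ->
  nm (Phi b - Phi a) <= 2 * M * (b - a).
Proof.
move=> hP a2 b2 ab hM.
have := @primitive_increment _ _ 0 _ _ M hP a2 b2 ab.
by rewrite mul0r subr0; apply=> t ht; rewrite subr0 hM.
Qed.

End Prim.

(** * Goursat's theorem *)

Ltac range_lra :=
  repeat match goal with H : is_true (_ && _) |- _ => case/andP: H => ? ? end;
  try (apply/andP; split); lra.

Section Goursat.
Variable R : realType.

(** The intervals from [u n] to [u n + L / 2 ^+ n] are nested, so every right end bounds all the
    left ends, and the supremum of the left ends lies in every interval. *)
Lemma nested_halving (L : R) (u : nat -> R) : 0 <= L ->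
  (forall n, u n.+1 = u n \/ u n.+1 = u n + L / 2 ^+ n.+1) ->
  exists x, forall n, u n <= x <= u n + L / 2 ^+ n.
Proof.
move=> L0 hu.
have p0 n : 0 < (2 : R) ^+ n by rewrite exprn_gt0.
have half n : L / 2 ^+ n = L / 2 ^+ n.+1 + L / 2 ^+ n.+1.
  by rewrite exprS; field; rewrite gt_eqF.
have l0 n : 0 <= L / 2 ^+ n by rewrite divr_ge0 // ltW.
have up n k : u n <= u (n + k)%N.
  elim: k => [|k ih]; first by rewrite addn0.
  rewrite addnS; apply: le_trans ih _.
  by case: (hu (n + k)%N) => ->; rewrite ?lerDl.
have dn n k : u (n + k)%N + L / 2 ^+ (n + k) <= u n + L / 2 ^+ n.
  elim: k => [|k ih]; first by rewrite addn0.
  rewrite addnS; apply: le_trans ih; have := half (n + k)%N.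
  by have := l0 (n + k).+1; case: (hu (n + k)%N) => ->; lra.
have bd m n : u m <= u n + L / 2 ^+ n.
  apply: le_trans (dn n m); apply: le_trans (_ : u (n + m)%N <= _).
    by rewrite addnC up.
  by rewrite lerDl.
have hs : has_sup (range u).
  split; first by exists (u 0%N); exists 0%N.
  by exists (u 0%N + L / 2 ^+ 0) => _ [m _ <-]; exact: bd.
exists (sup (range u)) => n; apply/andP; split.
  by apply: ub_le_sup; [exact: hs.2 | exists n].
by apply: ge_sup; [exact: hs.1 | move=> _ [m _ <-]; exact: bd].
Qed.

(** If [Pr] failed on the whole rectangle, it would fail on one quarter at each stage. These
    quarters shrink to a point, where the local hypothesis makes [Pr] hold at small scales, a
    contradiction. *)
Lemma rectangle_bisection (Pr : nat -> R -> R -> Prop) (a c L M : R) :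
  0 <= L -> 0 <= M ->
  (forall n a' c', let l := L / 2 ^+ n.+1 in let m := M / 2 ^+ n.+1 in
     Pr n.+1 a' c' -> Pr n.+1 (a' + l) c' ->
     Pr n.+1 a' (c' + m) -> Pr n.+1 (a' + l) (c' + m) -> Pr n a' c') ->
  (forall x y, a <= x <= a + L -> c <= y <= c + M ->
     exists2 D : R, 0 < D & forall n a' c',
       a' <= x <= a' + L / 2 ^+ n -> c' <= y <= c' + M / 2 ^+ n ->
       L / 2 ^+ n < D -> M / 2 ^+ n < D -> Pr n a' c') ->
  Pr 0%N a c.
Proof.
move=> L0 M0 split4 loc; apply: contrapT => nPr.
(* The failure of [Pr] sits under the existential as a premise, so that a successor exists for every
   state and [choice] yields a total function to iterate. *)
have step (s : nat * (R * R)) : exists p : R * R,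
    ~ Pr s.1 s.2.1 s.2.2 ->
    [/\ ~ Pr s.1.+1 p.1 p.2,
        p.1 = s.2.1 \/ p.1 = s.2.1 + L / 2 ^+ s.1.+1 &
        p.2 = s.2.2 \/ p.2 = s.2.2 + M / 2 ^+ s.1.+1].
  case: s => n [a' c'] /=.
  have [h|h] := pselect (Pr n a' c'); first by exists (a', c').
  set l := L / 2 ^+ n.+1; set m := M / 2 ^+ n.+1.
  have [h1|h1] := pselect (Pr n.+1 a' c'); last first.
    by exists (a', c') => _; split => //=; left.
  have [h2|h2] := pselect (Pr n.+1 (a' + l) c'); last first.
    by exists (a' + l, c') => _; split => //=; [right | left].
  have [h3|h3] := pselect (Pr n.+1 a' (c' + m)); last first.
    by exists (a', c' + m) => _; split => //=; [left | right].
  have [h4|h4] := pselect (Pr n.+1 (a' + l) (c' + m)); last first.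
    by exists (a' + l, c' + m) => _; split => //=; right.
  by case: h; apply: split4.
have [g hg] := choice step.
pose s := fix s n := if n is n'.+1 then g (n', s n') else (a, c).
have ns n : ~ Pr n (s n).1 (s n).2.
  by elim: n => //= n ih; have [] := hg (n, s n) ih.
have [x hx] : exists x, forall n, (s n).1 <= x <= (s n).1 + L / 2 ^+ n.
  by apply: nested_halving => // n; have [] := hg (n, s n) (ns n).
have [y hy] : exists y, forall n, (s n).2 <= y <= (s n).2 + M / 2 ^+ n.
  by apply: nested_halving => // n; have [] := hg (n, s n) (ns n).
have [||D D0 HD] := loc x y.
- by have := hx 0%N; rewrite /= expr0 divr1.
- by have := hy 0%N; rewrite /= expr0 divr1.
have [n hn] : exists n, (L + M) / 2 ^+ n < D.
  have [k hk] : exists k : nat, (L + M) / D < k%:R.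
    exists (Num.truncn ((L + M) / D)).+1; rewrite truncnS_gt //.
  exists k; rewrite ltr_pdivrMr ?exprn_gt0 //.
  rewrite mulrC -ltr_pdivrMr //; apply: lt_le_trans hk _.
  by rewrite -natrX ler_nat ltnW // ltn_expl.
have p0 : 0 < (2 : R) ^+ n by rewrite exprn_gt0.
apply: (ns n); apply: HD => //; apply: le_lt_trans hn;
  by rewrite ler_pM2r ?invr_gt0 // ?lerDl ?lerDr.
Qed.

Section Rectangle.
Variables (q : R[i] -> R[i]) (A B : R -> R -> R[i]).
Hypothesis hA : forall y : R, primitive (fun x => q (x +i* y)) (A ^~ y).
Hypothesis hB : forall x : R, primitive (fun y => q (x +i* y)) (B x).

(* As [A] and [B] are primitives of [q] in [x] and in [y], this is the contour
   integral of [q] along the boundary of [a, b] x [c, d]. *)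
Definition contour (a b c d : R) : R[i] :=
  'i * (B b d - B a d - B b c + B a c) - (A b d - A a d - A b c + A a c).

(** Near the point, [q] is affine up to an error proportional to the size of the rectangle.
    Constants cancel between opposite sides, and the two linear contributions,
    ['i * q' * (b - a) * (d - c)] each, cancel in the contour. What remains is error times side
    length, hence quadratic. *)
Lemma contour_local (x y : R) (q' : R[i]) :
  -1 <= x <= 1 -> -1 <= y <= 1 ->
  is_derive (x +i* y : R[i]^o) (1 : R[i]^o) (q : R[i]^o -> R[i]^o) (q' : R[i]^o) ->
  forall e : R, 0 < e -> exists2 D : R, 0 < D & forall a b c d,
    a <= x <= b -> c <= y <= d -> b - a < D -> d - c < D ->
    nm (contour a b c d) <= e * ((b - a) + (d - c)) ^+ 2.
Proof.
move=> x1 y1 /is_cderiveP dq e e0.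
(* The difference of two opposite sides doubles the error and [primitive_increment] doubles it
   again. *)
have [|D D0 HD] := dq (e / 4); first by rewrite divr_gt0.
(* The bound 1 keeps the rectangle inside the range -2 to 2 of the primitives; [D / 2] for each side
   makes their sum [s] smaller than [D]. *)
exists (Num.min 1 (D / 2)); first by rewrite lt_min ltr01 divr_gt0.
move=> a b c d xab ycd; rewrite !lt_min => /andP[ab1 abD] /andP[cd1 cdD].
set s := (b - a) + (d - c).
have est u v : a <= u <= b -> c <= v <= d ->
    nm (q (u +i* v) - q (x +i* y) - q' * ((u - x) +i* (v - y))) <= e / 4 * s.
  move=> uab vcd.
  have hs : nm ((u - x) +i* (v - y)) <= s.
    apply: le_trans (nm_le_ReIm _) _ => /=; apply: lerD; rewrite ler_norml; range_lra.
  have := HD ((u - x) +i* (v - y)).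
  have -> : (x +i* y) + ((u - x) +i* (v - y)) = u +i* v.
    by congr (_ +i* _); ring.
  move=> h; apply: le_trans (h _) _.
    by apply: le_lt_trans hs _; rewrite /s; range_lra.
  by rewrite ler_wpM2l // divr_ge0 // ltW.
have hAA : nm (A b d - A b c - (A a d - A a c) - q' * (0 +i* (d - c)) * (b - a)%:C)
    <= 2 * (e / 2 * s) * (b - a).
  apply: (primitive_increment (primitiveB (hA d) (hA c))); [range_lra..|].
  move=> t tab; have h1 := est t d tab; have h2 := est t c tab.
  have -> : q (t +i* d) - q (t +i* c) - q' * (0 +i* (d - c)) =
    (q (t +i* d) - q (x +i* y) - q' * ((t - x) +i* (d - y))) -
    (q (t +i* c) - q (x +i* y) - q' * ((t - x) +i* (c - y))).
    have -> : 0 +i* (d - c) = ((t - x) +i* (d - y)) - ((t - x) +i* (c - y)).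
      by congr (_ +i* _); ring.
    ring.
  apply: le_trans (nmB _ _) _.
  have -> : e / 2 * s = e / 4 * s + e / 4 * s by field.
  by apply: lerD; [apply: h1; range_lra | apply: h2; range_lra].
have hBB : nm (B b d - B a d - (B b c - B a c) - q' * (b - a)%:C * (d - c)%:C)
    <= 2 * (e / 2 * s) * (d - c).
  apply: (primitive_increment (primitiveB (hB b) (hB a))); [range_lra..|].
  move=> t tcd.
  have -> : q (b +i* t) - q (a +i* t) - q' * (b - a)%:C =
    (q (b +i* t) - q (x +i* y) - q' * ((b - x) +i* (t - y))) -
    (q (a +i* t) - q (x +i* y) - q' * ((a - x) +i* (t - y))).
    have -> : (b - a)%:C = ((b - x) +i* (t - y)) - ((a - x) +i* (t - y)).
      by congr (_ +i* _); ring.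
    ring.
  apply: le_trans (nmB _ _) _.
  have -> : e / 2 * s = e / 4 * s + e / 4 * s by field.
  by apply: lerD; apply: est => //; range_lra.
have -> : contour a b c d =
    'i * (B b d - B a d - (B b c - B a c) - q' * (b - a)%:C * (d - c)%:C) -
    (A b d - A b c - (A a d - A a c) - q' * (0 +i* (d - c)) * (b - a)%:C).
  have -> : 0 +i* (d - c) = 'i * (d - c)%:C 
    by apply/eqP; rewrite eq_complex /=; apply/andP; split; apply/eqP; ring.
  by rewrite /contour; ring.
apply: le_trans (nmB _ _) _; rewrite Normc.normcM nm_i mul1r.
have -> : e * s ^+ 2 = 2 * (e / 2 * s) * (d - c) + 2 * (e / 2 * s) * (b - a).
  by rewrite /s; field.
exact: lerD.
Qed.

(** The contour of a rectangle is the sum of those of its quarters, and [contour_local] beats the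
    bound [e / 4 ^ n] on small rectangles, so bisection gives the bound [e] on the whole one, for
    every [e]. *)
Lemma goursat_rectangle (a b c d : R) :
  -1 <= a <= b -> b <= 1 -> -1 <= c <= d -> d <= 1 ->
  (forall x y, a <= x <= b -> c <= y <= d ->
     derivable (q : R[i]^o -> R[i]^o) (x +i* y) 1) ->
  contour a b c d = 0.
Proof.
move=> /andP[a1 ab] b1 /andP[c1 cd] d1 dq.
apply: Normc.eq0_normc; apply: le_anti; rewrite nm_ge0 andbT.
apply/ler_addgt0Pr => e e0; rewrite add0r.
set L := b - a; set M := d - c.
have L0 : 0 <= L by rewrite subr_ge0.
have M0 : 0 <= M by rewrite subr_ge0.
(* A quarter of the allowance goes to each of the four subrectangles. *)
pose Pr n a' c' := nm (contour a' (a' + L / 2 ^+ n) c' (c' + M / 2 ^+ n))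
  <= e / (2 ^+ n) ^+ 2.
have : Pr 0%N a c.
  apply: (@rectangle_bisection Pr a c L M) => //.
    move=> n a' c' l m; rewrite /Pr -/l -/m.
    have hl : a' + L / 2 ^+ n = a' + l + l.
      by rewrite /l exprS; field; rewrite gt_eqF ?exprn_gt0.
    have hm : c' + M / 2 ^+ n = c' + m + m.
      by rewrite /m exprS; field; rewrite gt_eqF ?exprn_gt0.
    rewrite hl hm => h1 h2 h3 h4.
    have -> : contour a' (a' + l + l) c' (c' + m + m) =
      contour a' (a' + l) c' (c' + m) +
      contour (a' + l) (a' + l + l) c' (c' + m) +
      contour a' (a' + l) (c' + m) (c' + m + m) +
      contour (a' + l) (a' + l + l) (c' + m) (c' + m + m).
      by rewrite /contour; ring.
    have -> : e / (2 ^+ n) ^+ 2 = e / (2 ^+ n.+1) ^+ 2 + e / (2 ^+ n.+1) ^+ 2 +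
        e / (2 ^+ n.+1) ^+ 2 + e / (2 ^+ n.+1) ^+ 2.
      by rewrite [2 ^+ n.+1]exprS; field; rewrite gt_eqF ?exprn_gt0.
    do 3 (apply: le_trans (nmD _ _) _; apply: lerD => //).
  move=> x y xab ycd.
  (* At level [n] the sides sum to [(L + M) / 2 ^+ n], so dividing [e] by this number brings the
     local bound below the allowance; the 1 covers [L + M = 0]. *)
  have k0 : 0 < (L + M) ^+ 2 + 1 by rewrite ltr_wpDl ?sqr_ge0.
  have [||||D D0 HD] := @contour_local x y ('D_1 (q : R[i]^o -> R[i]^o) (x +i* y)) _ _ _
      (e / ((L + M) ^+ 2 + 1)).
  - by rewrite /L in xab; range_lra.
  - by rewrite /M in ycd; range_lra.
  - apply: derivableP; apply: dq; first by rewrite /L in xab; range_lra.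
    by rewrite /M in ycd; range_lra.
  - exact: divr_gt0.
  exists D => // n a' c' h1 h2 h3 h4.
  have p0 : 0 < (2 : R) ^+ n by rewrite exprn_gt0.
  have hl : a' + L / 2 ^+ n - a' = L / 2 ^+ n by rewrite addrC addKr.
  have hm : c' + M / 2 ^+ n - c' = M / 2 ^+ n by rewrite addrC addKr.
  have := HD _ _ _ _ h1 h2; rewrite hl hm => /(_ h3 h4) h5.
  apply: le_trans h5 _.
  have -> : L / 2 ^+ n + M / 2 ^+ n = (L + M) / 2 ^+ n by rewrite (mulrDl L M).
  rewrite expr_div_n mulrA; apply: ler_wpM2r; first by rewrite invr_ge0 sqr_ge0.
  rewrite mulrAC ler_pdivrMr //; apply: ler_wpM2l; first exact: ltW.
  by rewrite lerDl.
by rewrite /Pr !expr0 expr1n !divr1 /L /M !(addrC _ (_ - _)) !subrK.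
Qed.

End Rectangle.
End Goursat.

(** * Difference quotients and their removable singularity *)

Section Cauchy.
Variable R : realType.

Lemma hline_continuous (y : R) : continuous (fun x : R => x +i* y : R[i]^o).
Proof.
have -> : (fun x : R => x +i* y) = (fun x => (0 +i* y) + x%:C * 1).
  by apply/funext => x; rewrite mulr1; congr (_ +i* _); rewrite /= ?add0r ?addr0.
exact: line_continuous.
Qed.

Lemma vline_continuous (x : R) : continuous (fun y : R => x +i* y : R[i]^o).
Proof.
have -> : (fun y : R => x +i* y) = (fun y => x%:C + y%:C * 'i).
  by apply/funext => y; apply/eqP; rewrite eq_complex /=; apply/andP; split;
    apply/eqP; ring.
exact: line_continuous.
Qed.

Lemma near_nm (P : R[i] -> Prop) (w : R[i]) (D : R) : 0 < D ->
  (forall h, nm h < D -> P (w + h)) -> \forall v \near (w : R[i]^o), P v.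
Proof.
move=> D0 H; apply/nbhs_ballP; exists D%:C; rewrite /= ?ltcR // => v.
rewrite /ball /= normcE ltcR nmC => hv.
by rewrite -(subrK w v) addrC; exact: H.
Qed.

Lemma derivable_continuous (f : R[i] -> R[i]) (z : R[i]) :
  derivable (f : R[i]^o -> R[i]^o) z 1 ->
  {for z, continuous (f : R[i]^o -> R[i]^o)}.
Proof. by move=> /derivable1_diffP; exact: differentiable_continuous. Qed.

Lemma nm_continuous : continuous (fun z : R[i]^o => nm z : R).
Proof.
move=> z; apply: continuous_at_dist_le => e e0.
apply: (near_nm e0) => h /ltW; apply: le_trans.
have h1 := nmD z h; have h2 := nmB (z + h) h; rewrite addrK in h2.
by rewrite ler_norml; apply/andP; split; lra.
Qed.

Section Removable.
Variables (f : R[i] -> R[i]) (w : R[i]).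
Hypothesis f_hol : holomorphic f.

(** The value at [w] is the limit of the quotient, so the function is continuous everywhere and has
    primitives along lines through [w] as well. *)
Definition diff_quotient (z : R[i]) : R[i] :=
  if z == w then 'D_1 (f : R[i]^o -> R[i]^o) w else (f z - f w) * (z - w)^-1.

Lemma diff_quotient_derivable (z : R[i]) : z != w ->
  derivable (diff_quotient : R[i]^o -> R[i]^o) z 1.
Proof.
move=> zw.
apply: (@near_eq_derivable _ R[i]^o R[i]^o
  (fun v : R[i]^o => (f v - f w) * (v - w)^-1 : R[i]^o)).
  have d0 : 0 < nm (z - w) by rewrite nm_gt0 subr_eq0.
  apply: (near_nm d0) => h hh; rewrite /diff_quotient ifN //.
  apply: contraTneq hh => <-; rewrite opprD addNKr nmN -leNgt //.
apply: derivableM.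
  by apply: derivableB; [exact: f_hol | exact: derivable_cst].
apply: derivableV; first by rewrite subr_eq0.
by apply: derivableB; [exact: derivable_id | exact: derivable_cst].
Qed.

Lemma diff_quotient_continuous :
  continuous (diff_quotient : R[i]^o -> R[i]^o).
Proof.
move=> z; have [->|zw] := eqVneq z w; last first.
  exact/derivable_continuous/diff_quotient_derivable.
apply: continuous_at_dist_le => e e0.
have er : e = (complex.Re e)%:C by rewrite RRe_real // gtr0_real.
have e1 : 0 < complex.Re e by move: e0; rewrite {1}er ltcR.
have /is_cderiveP/(_ _ e1)[D D0 HD] := derivableP (@f_hol w).
apply: (near_nm D0) => h hD; rewrite normcE er lecR /diff_quotient eqxx.
have [hw|hw] := eqVneq (w + h) w.
  by rewrite subrr Normc.normc0 ltW.
have h0 : h != 0 by apply: contra_neq hw => ->; rewrite addr0.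
have -> : w + h - w = h by rewrite addrC addKr.
rewrite nmC -(ler_pM2r (_ : 0 < nm h)) ?nm_gt0 //.
apply: le_trans (HD h hD); rewrite -Normc.normcM mulrBl mulfVK //.
Qed.

(** Goursat applies to every rectangle that avoids [w]. A small square about [w] contributes at most
    a constant times its side, because the quotient is bounded near [w]. *)
Lemma contour_diff_quotient (A B : R -> R -> R[i]) :
  (forall y : R, primitive (fun x => diff_quotient (x +i* y)) (A ^~ y)) ->
  (forall x : R, primitive (fun y => diff_quotient (x +i* y)) (B x)) ->
  nm w < 2^-1 -> contour A B (-1) 1 (-1) 1 = 0.
Proof.
move=> hA hB w2.
have w1 : -2^-1 < complex.Re w < 2^-1.
  by rewrite -ltr_norml (le_lt_trans (ler_Re_nm w)).
have w3 : -2^-1 < complex.Im w < 2^-1.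
  by rewrite -ltr_norml (le_lt_trans (ler_Im_nm w)).
have wE : w = complex.Re w +i* complex.Im w by case: (w).
set a := complex.Re w in w1 wE; set b := complex.Im w in w3 wE.
have [M M0 [D D0 HM]] : exists2 M : R, 0 < M & exists2 D : R, 0 < D &
    forall h, nm h < D -> nm (diff_quotient (w + h)) <= M.
  have /cvgrPdist_le/(_ 1 ltr01)/nbhs_ballP[D D0 HD] := @diff_quotient_continuous w.
  have Dr : D = (complex.Re D)%:C by rewrite RRe_real // gtr0_real.
  exists (nm (diff_quotient w) + 1); first by rewrite ltr_wpDl // nm_ge0.
  exists (complex.Re D); first by move: D0; rewrite /= {1}Dr ltcR.
  move=> h hD; have := HD (w + h); rewrite /ball /= Dr normcE ltcR nmC.
  have -> : w + h - w = h by rewrite addrC addKr.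
  move=> /(_ hD); rewrite normcE (_ : 1 = 1%:C) // lecR => h1.
  rewrite -[diff_quotient (w + h)](subKr (diff_quotient w)).
  by apply: le_trans (nmB _ _) _; rewrite lerD2l.
have off x y : (x != a) || (y != b) ->
    derivable (diff_quotient : R[i]^o -> R[i]^o) (x +i* y) 1.
  move=> xy; apply: diff_quotient_derivable.
  by rewrite wE eq_complex /= negb_and.
apply: Normc.eq0_normc; apply: le_anti; rewrite nm_ge0 andbT.
apply/ler_addgt0Pr => e e0; rewrite add0r.
(* The first bound keeps the small square inside the large one, as [nm w < 2^-1]; the second keeps
   it where [M] bounds the quotient; the third brings its four sides, each at most [4 * (M * n)],
   below [e] in total. *)
set n := Num.min (4^-1) (Num.min (D / 4) (e / (16 * M))).
have n0 : 0 < n by rewrite !lt_min invr_gt0 ltr0n !divr_gt0 ?mulr_gt0.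
have [n4 nD ne] : [/\ n <= 4^-1, n <= D / 4 & n <= e / (16 * M)].
  by split; rewrite !ge_min lexx ?orbT.
clearbody n.
have side x0 y0 x1 y1 : -1 <= x0 <= x1 -> x1 <= 1 -> -1 <= y0 <= y1 -> y1 <= 1 ->
    [|| a < x0, x1 < a, b < y0 | y1 < b] -> contour A B x0 x1 y0 y1 = 0.
  move=> h1 h2 h3 h4 h5; apply: (goursat_rectangle hA hB) => // x y hx hy.
  apply: off; apply: contraTT h5; rewrite negb_or !negbK => /andP[/eqP xa /eqP yb].
  by rewrite -xa -yb !negb_or -!leNgt; move/andP: hx => [-> ->]; move/andP: hy => [-> ->].
(* The pieces are the strips left and right of the small square, the blocks below and above it, and
   the square itself. *)
have -> : contour A B (-1) 1 (-1) 1 =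
    contour A B (-1) (a - n) (-1) 1 + contour A B (a + n) 1 (-1) 1 +
    contour A B (a - n) (a + n) (-1) (b - n) +
    contour A B (a - n) (a + n) (b + n) 1 +
    contour A B (a - n) (a + n) (b - n) (b + n).
  by rewrite /contour; ring.
have -> : contour A B (-1) (a - n) (-1) 1 = 0.
  by apply: side; [range_lra..|]; apply/or4P/Or42; range_lra.
have -> : contour A B (a + n) 1 (-1) 1 = 0.
  by apply: side; [range_lra..|]; apply/or4P/Or41; range_lra.
have -> : contour A B (a - n) (a + n) (-1) (b - n) = 0.
  by apply: side; [range_lra..|]; apply/or4P/Or44; range_lra.
have -> : contour A B (a - n) (a + n) (b + n) 1 = 0.
  by apply: side; [range_lra..|]; apply/or4P/Or43; range_lra.
rewrite !add0r.
have bound x y : a - n <= x <= a + n -> b - n <= y <= b + n ->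
    nm (diff_quotient (x +i* y)) <= M.
  move=> hx hy; have := HM ((x - a) +i* (y - b)).
  have -> : w + ((x - a) +i* (y - b)) = x +i* y.
    by rewrite wE; congr (_ +i* _); ring.
  apply; apply: le_lt_trans (nm_le_ReIm _) _ => /=.
  have h1 : `|x - a| <= n by rewrite ler_norml; range_lra.
  have h2 : `|y - b| <= n by rewrite ler_norml; range_lra.
  by lra.
have hx y : b - n <= y <= b + n -> nm (A (a + n) y - A (a - n) y) <= 4 * (M * n).
  move=> hy; have -> : 4 * (M * n) = 2 * M * (a + n - (a - n)) by ring.
  apply: (primitive_increment0 (hA y)); [range_lra..|].
  by move=> t ht; exact: bound.
have hy x : a - n <= x <= a + n -> nm (B x (b + n) - B x (b - n)) <= 4 * (M * n).
  move=> hx'; have -> : 4 * (M * n) = 2 * M * (b + n - (b - n)) by ring.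
  apply: (primitive_increment0 (hB x)); [range_lra..|].
  by move=> t ht; exact: bound.
have -> : contour A B (a - n) (a + n) (b - n) (b + n) =
    'i * ((B (a + n) (b + n) - B (a + n) (b - n)) -
          (B (a - n) (b + n) - B (a - n) (b - n))) -
    ((A (a + n) (b + n) - A (a - n) (b + n)) -
     (A (a + n) (b - n) - A (a - n) (b - n))).
  by rewrite /contour; ring.
apply: le_trans (_ : 16 * (M * n) <= e); last first.
  by rewrite mulrA mulrC -ler_pdivlMr // mulr_gt0.
apply: le_trans (nmB _ _) _; rewrite Normc.normcM nm_i mul1r.
apply: le_trans (lerD (nmB _ _) (nmB _ _)) _.
have j1 : nm (A (a + n) (b + n) - A (a - n) (b + n)) <= 4 * (M * n) by apply: hx; range_lra.
have j2 : nm (A (a + n) (b - n) - A (a - n) (b - n)) <= 4 * (M * n) by apply: hx; range_lra.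
have j3 : nm (B (a + n) (b + n) - B (a + n) (b - n)) <= 4 * (M * n) by apply: hy; range_lra.
have j4 : nm (B (a - n) (b + n) - B (a - n) (b - n)) <= 4 * (M * n) by apply: hy; range_lra.
clear - j1 j2 j3 j4; lra.
Qed.

End Removable.
End Cauchy.

(** * Cauchy's formula *)

Lemma continuous_at_expr (K : numFieldType) (T : topologicalType)
    (f : T -> K^o) (t : T) (n : nat) :
  {for t, continuous f} -> {for t, continuous (fun s => f s ^+ n : K^o)}.
Proof.
move=> cf; elim: n => [|n ih]; first exact: cvg_cst.
have -> : (fun s => f s ^+ n.+1 : K^o) = (fun s => f s * f s ^+ n).
  by apply/funext => s; rewrite exprS.
exact: cvgM cf ih.
Qed.

Section CauchyFormula.
Variable R : realType.

Lemma nmX (z : R[i]) n : nm (z ^+ n) = nm z ^+ n.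
Proof.
by elim: n => [|n ih]; rewrite ?Normc.normc1 // !exprS Normc.normcM ih.
Qed.

(** The integral over [-1, 1]. [xget] picks some primitive, with the zero function as default where
    none exists. *)
Definition cint (phi : R -> R[i]) : R[i] :=
  let Phi := xget (fun=> 0) [set Phi | primitive phi Phi]%classic in
  Phi 1 - Phi (-1).

(** The difference of two primitives is a primitive of 0, hence constant by the increment bound with
    [M = 0]; so the choice made by [xget] is immaterial. *)
Lemma cint_primitive (phi Phi : R -> R[i]) :
  primitive phi Phi -> cint phi = Phi 1 - Phi (-1).
Proof.
move=> hPhi; rewrite /cint.
have := xgetPex (fun=> 0) (ex_intro (primitive phi) Phi hPhi).
set Psi := xget _ _ => hPsi.
have := @primitive_increment0 _ _ _ (-1) 1 0 (primitiveB hPsi hPhi).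
rewrite mulr0 mul0r => h; apply/eqP; rewrite -subr_eq0 -nm_eq0.
apply/eqP; apply: le_anti; rewrite nm_ge0 andbT.
have -> : Psi 1 - Psi (-1) - (Phi 1 - Phi (-1)) =
  Psi 1 - Phi 1 - (Psi (-1) - Phi (-1)) by ring.
apply: h; [lra..|].
by move=> t _; rewrite subrr Normc.normc0.
Qed.

Section Linearity.
Variables phi psi : R -> R[i]^o.
Hypotheses (cphi : continuous phi) (cpsi : continuous psi).

Lemma cintB : cint (fun t => phi t - psi t) = cint phi - cint psi.
Proof.
have [Phi hPhi] := primitive_exists cphi.
have [Psi hPsi] := primitive_exists cpsi.
rewrite (cint_primitive hPhi) (cint_primitive hPsi).
by rewrite (cint_primitive (primitiveB hPhi hPsi)); ring.
Qed.

Lemma cintZ (z : R[i]) : cint (fun t => z * phi t) = z * cint phi.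
Proof.
have [Phi hPhi] := primitive_exists cphi.
by rewrite (cint_primitive hPhi) (cint_primitive (primitiveZ z hPhi)); ring.
Qed.

Lemma nm_cint_le (M : R) :
  (forall t, -1 <= t <= 1 -> nm (phi t) <= M) -> nm (cint phi) <= 4 * M.
Proof.
move=> hM; have [Phi hPhi] := primitive_exists cphi.
rewrite (cint_primitive hPhi) (_ : 4 * M = 2 * M * (1 - -1)); last by ring.
by apply: (primitive_increment0 hPhi) => //; lra.
Qed.

Lemma continuous_bounded_nm :
  exists2 M : R, 0 <= M & forall t, -1 <= t <= 1 -> nm (phi t) <= M.
Proof.
have [|c _ hc] := @EVT_max R (fun t => nm (phi t)) (-1) 1 ltac:(lra).
  apply: continuous_subspaceT => t.
  apply: (@continuous_comp R R[i]^o R phi (fun z => nm z)); first exact: cphi.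
  exact: nm_continuous.
by exists (nm (phi c)); [exact: nm_ge0 | move=> t ht; apply: hc; rewrite in_itv].
Qed.

End Linearity.

(** Differentiation under the integral sign: a remainder quadratic in [h], uniformly in [t], stays
    quadratic after integration. *)
Lemma is_derive_cint (k : R -> R[i] -> R[i]) (k' : R -> R[i]) (w : R[i]) (C D : R) :
  0 < D -> 0 <= C ->
  (forall h, nm h < D -> continuous (fun t => k t (w + h) : R[i]^o)) ->
  continuous (k' : R -> R[i]^o) ->
  (forall h t, nm h < D -> -1 <= t <= 1 ->
     nm (k t (w + h) - k t w - k' t * h) <= C * nm h ^+ 2) ->
  is_derive (w : R[i]^o) (1 : R[i]^o)
    (fun v : R[i]^o => cint (fun t => k t v) : R[i]^o) (cint k' : R[i]^o).
Proof.
move=> D0 C0 ck ck' est; apply/is_cderiveP => e e0.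
have C1 : 0 < 4 * (C + 1) by rewrite mulr_gt0 // ltr_wpDl.
(* The integrated remainder is at most [4 * C * nm h ^+ 2]; this radius makes it at most [e * nm h],
   and [C + 1] avoids division by 0. *)
exists (Num.min D (e / (4 * (C + 1)))); first by rewrite lt_min D0 divr_gt0.
move=> h; rewrite lt_min => /andP[hD hC].
have ckw : continuous (fun t => k t w : R[i]^o).
  by have := ck 0; rewrite addr0 Normc.normc0; apply.
have cd : continuous (fun t => k t (w + h) - k t w : R[i]^o).
  by move=> t; apply: cvgB; [exact: ck | exact: ckw].
have ch : continuous (fun t => h * k' t : R[i]^o).
  by move=> t; apply: cvgM; [exact: cvg_cst | exact: ck'].
rewrite -(cintB (ck h hD) ckw) mulrC -(cintZ ck') -(cintB cd ch).
apply: le_trans (nm_cint_le (M := C * nm h ^+ 2) _ _) _.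
- by move=> t; apply: cvgB; [exact: cd | exact: ch].
- by move=> t ht; rewrite (mulrC h); exact: est.
have h0 := nm_ge0 h.
rewrite expr2 !mulrA; apply: ler_wpM2r => //.
apply: le_trans (_ : 4 * (C + 1) * nm h <= e).
  by apply: ler_wpM2r => //; rewrite ler_wpM2l // lerDl.
by rewrite mulrC -ler_pdivlMr // ltW.
Qed.

(** * Differentiation of Cauchy kernels with respect to the pole *)

Section Kernel.
Variables (phi gamma : R -> R[i]^o) (w : R[i]) (eta : R).
Hypotheses (cphi : continuous phi) (cgamma : continuous gamma).
Hypotheses (eta0 : 0 < eta) (far : forall t, eta <= nm (gamma t - w)).

Let far_shift h t : nm h < eta / 2 -> eta / 2 <= nm (gamma t - (w + h)).
Proof.
move=> hh; have := nmD (gamma t - (w + h)) h.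
have -> : gamma t - (w + h) + h = gamma t - w by ring.
by have := far t; lra.
Qed.

Lemma kernel_continuous n h : nm h < eta / 2 ->
  continuous (fun t => phi t * (gamma t - (w + h))^-1 ^+ n : R[i]^o).
Proof.
move=> hh t; apply: cvgM; first exact: cphi.
have ci : {for t, continuous (fun t => (gamma t - (w + h))^-1 : R[i]^o)}.
  apply: cvgV; last by apply: cvgB; [exact: cgamma | exact: cvg_cst].
  by rewrite -nm_gt0; apply: lt_le_trans (far_shift t hh); rewrite divr_gt0.
exact: continuous_at_expr ci.
Qed.

Let nm_inv t : nm (gamma t - w)^-1 <= eta^-1.
Proof.
by rewrite Normc.normcV lef_pV2 ?posrE // (lt_le_trans eta0).
Qed.

Let nm_inv_shift h t : nm h < eta / 2 -> nm (gamma t - (w + h))^-1 <= 2 / eta.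
Proof.
move=> hh; rewrite Normc.normcV -[2 / eta]invrK invf_div.
have e2 : 0 < eta / 2 by rewrite divr_gt0.
by rewrite lef_pV2 ?posrE ?(lt_le_trans e2) // far_shift.
Qed.

(** The resolvent identity. Each use extracts one factor [h], so two uses give the quadratic
    remainders required by [is_derive_cint]. *)
Let inv_shift h t : nm h < eta / 2 ->
  (gamma t - (w + h))^-1 = (gamma t - w)^-1 +
    h * (gamma t - w)^-1 * (gamma t - (w + h))^-1.
Proof.
move=> hh.
have n1 : gamma t - w != 0 by rewrite -nm_gt0 (lt_le_trans eta0).
have n2 : gamma t - w - h != 0.
  rewrite -addrA -opprD -nm_gt0; apply: lt_le_trans (far_shift t hh).
  by rewrite divr_gt0.
rewrite opprD addrA; move: n1 n2; set x := gamma t - w => n1 n2.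
by field; rewrite n1 n2.
Qed.

Let nm_aab h t : nm h < eta / 2 ->
  nm ((gamma t - w)^-1 ^+ 2 * (gamma t - (w + h))^-1) <= eta^-1 ^+ 2 * (2 / eta).
Proof.
move=> hh; rewrite Normc.normcM nmX.
apply: ler_pM; [exact/exprn_ge0/nm_ge0|exact: nm_ge0| |exact: nm_inv_shift].
by apply: lerXn2r; rewrite ?nnegrE ?nm_ge0 ?invr_ge0 ?(ltW eta0) ?nm_inv.
Qed.

Lemma is_derive_cauchy_kernel1 :
  is_derive (w : R[i]^o) (1 : R[i]^o)
    (fun v : R[i]^o => cint (fun t => phi t * (gamma t - v)^-1 ^+ 1) : R[i]^o)
    (cint (fun t => phi t * (gamma t - w)^-1 ^+ 2) : R[i]^o).
Proof.
have [M M0 hM] := continuous_bounded_nm cphi.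
have e2 : 0 < eta / 2 by rewrite divr_gt0.
have i0 : 0 <= eta^-1 by rewrite invr_ge0 ltW.
apply: (@is_derive_cint (fun t v => phi t * (gamma t - v)^-1 ^+ 1)
  (fun t => phi t * (gamma t - w)^-1 ^+ 2) w
  (M * (eta^-1 ^+ 2 * (2 / eta))) (eta / 2) e2).
- by rewrite !mulr_ge0 // exprn_ge0.
- exact: kernel_continuous.
- by have := @kernel_continuous 2 0; rewrite Normc.normc0 addr0; apply.
move=> h t hh ht; have ia := nm_inv t; have ib := nm_inv_shift t hh.
have := inv_shift t hh; set a := (gamma t - w)^-1 in ia *.
set b := (gamma t - (w + h))^-1 in ib * => bE.
(* Using [b - a = h * a * b] twice leaves an exact remainder; [M], [eta^-1] and [2 / eta] bound
   [phi], [a] and [b] in it. *)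
have -> : phi t * b ^+ 1 - phi t * a ^+ 1 - phi t * a ^+ 2 * h =
    phi t * (a ^+ 2 * b) * h ^+ 2.
  have -> : phi t * b ^+ 1 - phi t * a ^+ 1 - phi t * a ^+ 2 * h =
    phi t * ((b - a) - a ^+ 2 * h) by ring.
  have -> : b - a = h * a * b by rewrite {1}bE; ring.
  have -> : h * a * b - a ^+ 2 * h = h * a * (b - a) by ring.
  by rewrite {1}bE; ring.
rewrite Normc.normcM nmX; apply: ler_wpM2r; first exact: sqr_ge0.
rewrite Normc.normcM; apply: ler_pM; [exact: nm_ge0|exact: nm_ge0|exact: hM|].
exact: nm_aab hh.
Qed.

Lemma is_derive_cauchy_kernel2 :
  is_derive (w : R[i]^o) (1 : R[i]^o)
    (fun v : R[i]^o => cint (fun t => phi t * (gamma t - v)^-1 ^+ 2) : R[i]^o)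
    (cint (fun t => 2 * phi t * (gamma t - w)^-1 ^+ 3) : R[i]^o).
Proof.
have [M M0 hM] := continuous_bounded_nm cphi.
have e2 : 0 < eta / 2 by rewrite divr_gt0.
have i0 : 0 <= eta^-1 by rewrite invr_ge0 ltW.
apply: (@is_derive_cint (fun t v => phi t * (gamma t - v)^-1 ^+ 2)
  (fun t => 2 * phi t * (gamma t - w)^-1 ^+ 3) w
  (M * (eta^-1 ^+ 2 * (2 / eta)) * (4 / eta)) (eta / 2) e2).
- by rewrite !mulr_ge0 // exprn_ge0.
- exact: kernel_continuous.
- have c3 : continuous (fun t => phi t * (gamma t - w)^-1 ^+ 3 : R[i]^o).
    by have := @kernel_continuous 3 0; rewrite Normc.normc0 addr0; apply.
  have -> : (fun t => 2 * phi t * (gamma t - w)^-1 ^+ 3 : R[i]^o) =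
      (fun t => 2 * (phi t * (gamma t - w)^-1 ^+ 3)).
    by apply/funext => t; rewrite mulrA.
  by move=> t; apply: cvgM; [exact: cvg_cst | exact: c3].
move=> h t hh ht; have ia := nm_inv t; have ib := nm_inv_shift t hh.
have := inv_shift t hh; set a := (gamma t - w)^-1 in ia *.
set b := (gamma t - (w + h))^-1 in ib * => bE.
(* Again [b - a = h * a * b] is used twice. The new factor [a + a + b] accounts for the [4 / eta] in
   the constant. *)
have -> : phi t * b ^+ 2 - phi t * a ^+ 2 - 2 * phi t * a ^+ 3 * h =
    phi t * (a ^+ 2 * b) * (a + a + b) * h ^+ 2.
  have e1 : b - a = h * a * b by rewrite {1}bE; ring.
  have -> : phi t * b ^+ 2 - phi t * a ^+ 2 - 2 * phi t * a ^+ 3 * h =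
    phi t * ((b - a) * (b + a) - 2 * a ^+ 3 * h) by ring.
  rewrite e1.
  have -> : h * a * b * (b + a) - 2 * a ^+ 3 * h =
    h * a * (b - a) * (b + a + a) by ring.
  by rewrite e1; ring.
rewrite Normc.normcM nmX; apply: ler_wpM2r; first exact: sqr_ge0.
rewrite Normc.normcM; apply: ler_pM; [exact: nm_ge0|exact: nm_ge0| |]; last first.
  apply: le_trans (nmD _ _) _; apply: le_trans (lerD (nmD _ _) (lexx _)) _.
  have -> : 4 / eta = eta^-1 + eta^-1 + 2 / eta by field; rewrite gt_eqF.
  by rewrite !lerD.
rewrite Normc.normcM; apply: ler_pM; [exact: nm_ge0|exact: nm_ge0|exact: hM|].
exact: nm_aab hh.
Qed.

End Kernel.
End CauchyFormula.

(** The shape is that of the four side integrals in [cauchy_transform], with [c = 'i] on the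
    vertical sides. *)
Lemma is_derive_lincomb (K : numFieldType) (f1 f2 f3 f4 : K^o -> K^o)
    (x c d1 d2 d3 d4 : K^o) :
  is_derive x (1 : K^o) f1 d1 -> is_derive x (1 : K^o) f2 d2 ->
  is_derive x (1 : K^o) f3 d3 -> is_derive x (1 : K^o) f4 d4 ->
  is_derive x (1 : K^o) (fun v => f1 v - f2 v + c * f3 v - c * f4 v : K^o)
    (d1 - d2 + c * d3 - c * d4).
Proof.
move=> h1 h2 h3 h4.
exact: (is_deriveB (is_deriveD (is_deriveB h1 h2) (is_deriveZ c h3))
  (is_deriveZ c h4)).
Qed.

(** * Cauchy transforms over the boundary of the square *)

Section SquareBoundary.
Variable R : realType.

(* [\oint g(z) (z - w)^(- n) dz] along the boundary of [-1, 1] x [-1, 1]. *)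
Definition cauchy_transform (g : R[i] -> R[i]) (n : nat) (w : R[i]) : R[i] :=
  cint (fun t : R => g (t +i* -1) * (t +i* -1 - w)^-1 ^+ n) -
  cint (fun t : R => g (t +i* 1) * (t +i* 1 - w)^-1 ^+ n) +
  'i * cint (fun t : R => g (1 +i* t) * (1 +i* t - w)^-1 ^+ n) -
  'i * cint (fun t : R => g (-1 +i* t) * (-1 +i* t - w)^-1 ^+ n).

Variable w : R[i].
Hypothesis w_small : nm w < 2^-1.

Let Re_small : `|complex.Re w| < 2^-1.
Proof. exact: le_lt_trans (ler_Re_nm w) w_small. Qed.

Let Im_small : `|complex.Im w| < 2^-1.
Proof. exact: le_lt_trans (ler_Im_nm w) w_small. Qed.

(** The side lies on a line at distance at least 1/2 from [w], so the bound holds for every real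
    [t], and the kernels are continuous on all of [R]. The other three sides are alike. *)
Lemma far_bottom (t : R) : 2^-1 <= nm (t +i* -1 - w).
Proof.
apply: le_trans (ler_Im_nm _); case: (w) Im_small => a b /=; rewrite ltr_norml => h.
by rewrite ler_normr; apply/orP; right; range_lra.
Qed.

Lemma far_top (t : R) : 2^-1 <= nm (t +i* 1 - w).
Proof.
apply: le_trans (ler_Im_nm _); case: (w) Im_small => a b /=; rewrite ltr_norml => h.
by rewrite ler_normr; apply/orP; left; range_lra.
Qed.

Lemma far_right (t : R) : 2^-1 <= nm (1 +i* t - w).
Proof.
apply: le_trans (ler_Re_nm _); case: (w) Re_small => a b /=; rewrite ltr_norml => h.
by rewrite ler_normr; apply/orP; left; range_lra.
Qed.

Lemma far_left (t : R) : 2^-1 <= nm (-1 +i* t - w).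
Proof.
apply: le_trans (ler_Re_nm _); case: (w) Re_small => a b /=; rewrite ltr_norml => h.
by rewrite ler_normr; apply/orP; right; range_lra.
Qed.

Section Continuous.
Variable g : R[i]^o -> R[i]^o.
Hypothesis cg : continuous g.

Lemma continuous_hline (y : R) : continuous (fun x : R => g (x +i* y)).
Proof.
by move=> x; apply: (@continuous_comp R R[i]^o R[i]^o);
  [exact: hline_continuous | exact: cg].
Qed.

Lemma continuous_vline (x : R) : continuous (fun y : R => g (x +i* y)).
Proof.
by move=> y; apply: (@continuous_comp R R[i]^o R[i]^o);
  [exact: vline_continuous | exact: cg].
Qed.

Let h20 : 0 < 2^-1 :> R. Proof. by rewrite invr_gt0. Qed.

Lemma is_derive_cauchy_transform1 :
  is_derive (w : R[i]^o) (1 : R[i]^o)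
    (cauchy_transform g 1 : R[i]^o -> R[i]^o) (cauchy_transform g 2 w : R[i]^o).
Proof.
apply: is_derive_lincomb; apply: is_derive_cauchy_kernel1 h20 _.
- exact: continuous_hline.
- exact: hline_continuous.
- exact: far_bottom.
- exact: continuous_hline.
- exact: hline_continuous.
- exact: far_top.
- exact: continuous_vline.
- exact: vline_continuous.
- exact: far_right.
- exact: continuous_vline.
- exact: vline_continuous.
- exact: far_left.
Qed.

Lemma is_derive_cauchy_transform2 :
  is_derive (w : R[i]^o) (1 : R[i]^o)
    (cauchy_transform g 2 : R[i]^o -> R[i]^o)
    (cauchy_transform (fun z => 2 * g z) 3 w : R[i]^o).
Proof.
apply: is_derive_lincomb; apply: is_derive_cauchy_kernel2 h20 _.
- exact: continuous_hline.
- exact: hline_continuous.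
- exact: far_bottom.
- exact: continuous_hline.
- exact: hline_continuous.
- exact: far_top.
- exact: continuous_vline.
- exact: vline_continuous.
- exact: far_right.
- exact: continuous_vline.
- exact: vline_continuous.
- exact: far_left.
Qed.

Lemma cauchy_kernel_hline (y : R) : (forall t : R, 2^-1 <= nm (t +i* y - w)) ->
  continuous (fun t : R => g (t +i* y) * (t +i* y - w)^-1 : R[i]^o).
Proof.
move=> hf t; apply: cvgM; first exact: continuous_hline.
apply: cvgV; last by apply: cvgB; [exact: hline_continuous | exact: cvg_cst].
by rewrite -nm_gt0 (lt_le_trans h20).
Qed.

Lemma cauchy_kernel_vline (x : R) : (forall t : R, 2^-1 <= nm (x +i* t - w)) ->
  continuous (fun t : R => g (x +i* t) * (x +i* t - w)^-1 : R[i]^o).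
Proof.
move=> hf t; apply: cvgM; first exact: continuous_vline.
apply: cvgV; last by apply: cvgB; [exact: vline_continuous | exact: cvg_cst].
by rewrite -nm_gt0 (lt_le_trans h20).
Qed.

End Continuous.

(** On the boundary the difference quotient splits into [f z / (z - w)] minus [f w / (z - w)], and
    its contour integral vanishes. The integral of [1 / (z - w)] stays as a function of [w], so its
    value is never computed. *)
Lemma cauchy_formula (f : R[i] -> R[i]) : holomorphic f ->
  cauchy_transform f 1 w = f w * cauchy_transform (fun=> 1) 1 w.
Proof.
move=> fh.
have cf : continuous (f : R[i]^o -> R[i]^o).
  by move=> z; apply: derivable_continuous; exact: fh.
have c1 : continuous ((fun=> 1) : R[i]^o -> R[i]^o) by exact: (@cst_continuous R[i]^o R[i]^o 1).
have cq := diff_quotient_continuous (w := w) fh.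
have [A hA] := choice (fun y => primitive_exists (@continuous_hline _ cq y)).
have [B hB] := choice (fun x => primitive_exists (@continuous_vline _ cq x)).
have := contour_diff_quotient fh (A := fun x y => A y x) hA hB w_small.
have h20 : 0 < 2^-1 :> R by rewrite invr_gt0.
have sideE (gamma : R -> R[i]) (Phi : R -> R[i]) :
    continuous (fun t => f (gamma t) * (gamma t - w)^-1 : R[i]^o) ->
    continuous (fun t => 1 * (gamma t - w)^-1 : R[i]^o) ->
    (forall t, 2^-1 <= nm (gamma t - w)) ->
    primitive (fun t => diff_quotient f w (gamma t)) Phi ->
    Phi 1 - Phi (-1) = cint (fun t => f (gamma t) * (gamma t - w)^-1 ^+ 1) -
      f w * cint (fun t => 1 * (gamma t - w)^-1 ^+ 1).
  move=> k1 k2 far hPhi; rewrite -(cint_primitive hPhi).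
  have k3 : continuous (fun t => f w * (1 * (gamma t - w)^-1) : R[i]^o).
    by move=> t; apply: cvgM; [exact: cvg_cst | exact: k2].
  rewrite -(cintZ k2) -(cintB k1 k3); congr cint; apply/funext => t.
  rewrite /diff_quotient ifN; first by rewrite mul1r mulrBl.
  by rewrite -subr_eq0 -nm_gt0 (lt_le_trans h20).
have s1 := sideE _ _ (cauchy_kernel_hline cf far_bottom)
  (cauchy_kernel_hline c1 far_bottom) far_bottom (hA (-1)).
have s2 := sideE _ _ (cauchy_kernel_hline cf far_top)
  (cauchy_kernel_hline c1 far_top) far_top (hA 1).
have s3 := sideE _ _ (cauchy_kernel_vline cf far_right)
  (cauchy_kernel_vline c1 far_right) far_right (hB 1).
have s4 := sideE _ _ (cauchy_kernel_vline cf far_left)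
  (cauchy_kernel_vline c1 far_left) far_left (hB (-1)).
rewrite /contour.
(* The contour is regrouped into the increments along the bottom, top, right and left sides. *)
have -> : 'i * (B 1 1 - B (-1) 1 - B 1 (-1) + B (-1) (-1)) -
    (A 1 1 - A 1 (-1) - A (-1) 1 + A (-1) (-1)) =
  (A (-1) 1 - A (-1) (-1)) - (A 1 1 - A 1 (-1)) + 'i * (B 1 1 - B 1 (-1)) -
  'i * (B (-1) 1 - B (-1) (-1)) by ring.
rewrite s1 s2 s3 s4 => /eqP; rewrite /cauchy_transform -subr_eq0 => /eqP E.
by apply/eqP; rewrite -subr_eq0; apply/eqP; rewrite -[RHS]E; ring.
Qed.

End SquareBoundary.

(** * The derivative of a holomorphic function is holomorphic *)

Section Derivative.
Variable R : realType.

(** Added over a common parameter [t], the four integrands give [4 / (1 + t ^+ 2)] times ['i]. On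
    [-1, 1] this lies within 1 of [3 'i], so the integral lies within 4 of [6 'i] and cannot be
    0. *)
Lemma cauchy_transform1_neq0 : cauchy_transform (fun=> (1 : R[i])) 1 0 != 0.
Proof.
have w0 : nm (0 : R[i]) < 2^-1 by rewrite Normc.normc0 invr_gt0.
have c1 : continuous ((fun=> 1) : R[i]^o -> R[i]^o) by exact: (@cst_continuous R[i]^o R[i]^o 1).
have [P1 h1] := primitive_exists (cauchy_kernel_hline c1 (far_bottom w0)).
have [P2 h2] := primitive_exists (cauchy_kernel_hline c1 (far_top w0)).
have [P3 h3] := primitive_exists (cauchy_kernel_vline c1 (far_right w0)).
have [P4 h4] := primitive_exists (cauchy_kernel_vline c1 (far_left w0)).
have hP := primitiveB (primitiveD (primitiveB h1 h2) (primitiveZ 'i h3))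
  (primitiveZ 'i h4).
rewrite /cauchy_transform (cint_primitive h1) (cint_primitive h2).
rewrite (cint_primitive h3) (cint_primitive h4).
apply/eqP => E0.
have := @primitive_increment _ _ _ (0 +i* 3) (-1) 1 1 hP.
have -> : P1 1 - P2 1 + 'i * P3 1 - 'i * P4 1 -
    (P1 (-1) - P2 (-1) + 'i * P3 (-1) - 'i * P4 (-1)) =
    P1 1 - P1 (-1) - (P2 1 - P2 (-1)) + 'i * (P3 1 - P3 (-1)) -
    'i * (P4 1 - P4 (-1)) by ring.
rewrite E0 sub0r nmN => H.
suff : nm ((0 +i* 3) * (1 - -1)%:C) <= 2 * 1 * (1 - -1) :> R.
  rewrite Normc.normcM nm_real (_ : 0 +i* 3 = 3%:C * 'i); last first.
    by apply/eqP; rewrite eq_complex /=; apply/andP; split; apply/eqP; ring.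
  rewrite Normc.normcM nm_real nm_i !ger0_norm; lra.
apply: H; [lra..|] => t ht.
have n0 : 1 + t ^+ 2 != 0 by rewrite gt_eqF // ltr_pwDl // sqr_ge0.
have -> : 1 * (t +i* -1 - 0)^-1 - 1 * (t +i* 1 - 0)^-1 +
    'i * (1 * (1 +i* t - 0)^-1) - 'i * (1 * (-1 +i* t - 0)^-1) - (0 +i* 3) =
    (4 / (1 + t ^+ 2) - 3)%:C * 'i.
  rewrite !subr0 !mul1r; apply/eqP; rewrite eq_complex /=.
  have -> : t ^+ 2 + (-1) ^+ 2 = 1 + t ^+ 2 by ring.
  have -> : t ^+ 2 + 1 ^+ 2 = 1 + t ^+ 2 by ring.
  have -> : 1 ^+ 2 + t ^+ 2 = 1 + t ^+ 2 by ring.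
  have -> : (-1) ^+ 2 + t ^+ 2 = 1 + t ^+ 2 by ring.
  by apply/andP; split; apply/eqP; field.
rewrite Normc.normcM nm_i mulr1 nm_real.
have t0 : 0 < 1 + t ^+ 2 by rewrite lt_def n0 addr_ge0 // sqr_ge0.
have t1 : t ^+ 2 <= 1 by rewrite -real_normK ?num_real // exprn_ile1 // ler_norml.
rewrite ler_norml; apply/andP; split.
  have : 2 <= 4 / (1 + t ^+ 2) by rewrite ler_pdivlMr //; lra.
  by lra.
have : 4 / (1 + t ^+ 2) <= 4 by rewrite ler_pdivrMr //; have := sqr_ge0 t; lra.
by lra.
Qed.

(** Differentiating Cauchy's formula [S 1 = f * c 1] gives [S 2 = f * c 2 + f' * c 1]. Near 0, where
    [c 1] is nonzero, this solves for [f'] in terms of functions that are all differentiable at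
    0. *)
Lemma holomorphic_derive_at0 (f : R[i] -> R[i]) : holomorphic f ->
  derivable ('D_1 (f : R[i]^o -> R[i]^o) : R[i]^o -> R[i]^o) 0 1.
Proof.
move=> fh.
have cf : continuous (f : R[i]^o -> R[i]^o).
  by move=> z; apply: derivable_continuous; exact: fh.
have c1 : continuous ((fun=> 1) : R[i]^o -> R[i]^o) by exact: (@cst_continuous R[i]^o R[i]^o 1).
have h20 : 0 < 2^-1 :> R by rewrite invr_gt0.
have w0 : nm (0 : R[i]) < 2^-1 by rewrite Normc.normc0.
pose c n : R[i]^o -> R[i]^o := cauchy_transform (fun=> 1) n.
pose S n : R[i]^o -> R[i]^o := cauchy_transform f n.
have near_small w : nm w < 2^-1 -> \forall v \near (w : R[i]^o), nm v < 2^-1.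
  move=> hw; have d0 : 0 < 2^-1 - nm w by rewrite subr_gt0.
  by apply: (near_nm d0) => h hh; apply: le_lt_trans (nmD _ _) _; lra.
have dc : derivable (c 1%N) 0 1 by have [] := is_derive_cauchy_transform1 w0 c1.
have c_neq0 : \forall v \near (0 : R[i]^o), c 1%N v != 0.
  have := derivable_continuous dc.
  by move/cvgr_neq0; apply; exact: cauchy_transform1_neq0.
apply: (@near_eq_derivable _ R[i]^o R[i]^o
  (fun v => (S 2%N v - f v * c 2%N v) * (c 1%N v)^-1 : R[i]^o)).
  apply: filterS2 (near_small _ w0) c_neq0 => v v_small cv0.
  have dS := is_derive_cauchy_transform1 v_small cf.
  have dcv := is_derive_cauchy_transform1 v_small c1.
  have dfv : is_derive (v : R[i]^o) (1 : R[i]^o) (f : R[i]^o -> R[i]^o)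
    ('D_1 (f : R[i]^o -> R[i]^o) v) by apply: derivableP; exact: fh.
  have dM := is_deriveM dfv dcv.
  (* By Cauchy's formula the product agrees with [S 1] near [v], so its derivative is [S 2 v]; [E]
     compares this with the product rule. *)
  have dSM : is_derive (v : R[i]^o) (1 : R[i]^o)
      (fun u : R[i]^o => f u * c 1%N u : R[i]^o) (S 2%N v).
    apply: near_eq_is_derive dS.
    by apply: filterS (near_small _ v_small) => u hu; exact: cauchy_formula.
  have E : S 2%N v = f v * c 2%N v + c 1%N v * 'D_1 (f : R[i]^o -> R[i]^o) v.
    by rewrite -(@derive_val _ _ _ _ _ _ _ dSM); exact: (@derive_val _ _ _ _ _ _ _ dM).
  by rewrite E; field.
apply: derivableM; last by apply: derivableV; [exact: cauchy_transform1_neq0 | exact: dc].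
apply: derivableB; first by have [] := is_derive_cauchy_transform2 w0 cf.
apply: derivableM; first exact: fh.
by have [] := is_derive_cauchy_transform2 w0 c1.
Qed.

Lemma is_derive_shift (f : R[i] -> R[i]) (z v d : R[i]) :
  is_derive (v + z : R[i]^o) (1 : R[i]^o) (f : R[i]^o -> R[i]^o) (d : R[i]^o) <->
  is_derive (v : R[i]^o) (1 : R[i]^o)
    (fun u : R[i]^o => f (u + z) : R[i]^o) (d : R[i]^o).
Proof.
rewrite !is_cderiveP; split=> H e e0; have [D D0 HD] := H e e0;
  by exists D => // h /HD; rewrite (addrAC v z h).
Qed.

Lemma holomorphic_of_derive (f f' : R[i] -> R[i]) : holomorphic f ->
  (forall z, 'D_1 (f : R[i]^o -> R[i]^o) z = f' z) -> holomorphic f'.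
Proof.
move=> fh f'E z.
pose g : R[i] -> R[i] := fun v => f (v + z).
have dg v : is_derive (v : R[i]^o) (1 : R[i]^o) (g : R[i]^o -> R[i]^o) (f' (v + z)).
  by apply/is_derive_shift; rewrite -f'E; apply: derivableP; exact: fh.
have gh : holomorphic g by move=> v; have [] := dg v.
have : derivable (fun v : R[i]^o => f' (v + z) : R[i]^o) 0 1.
  have <- : 'D_1 (g : R[i]^o -> R[i]^o) = (fun v => f' (v + z)).
    by apply/funext => v; exact: (@derive_val _ _ _ _ _ _ _ (dg v)).
  exact: holomorphic_derive_at0.
by move=> /derivableP/is_derive_shift; rewrite add0r => -[].
Qed.

End Derivative.

(** * Products of harmonic functions and polynomials *)

Lemma continuous_at_add (K : numFieldType) (T : topologicalType)
    (f g : T -> K^o) (x : T) : {for x, continuous f} -> {for x, continuous g} ->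
  {for x, continuous (fun y => f y + g y : K^o)}.
Proof. by move=> cf cg; exact: cvgD cf cg. Qed.

Lemma continuous_at_mul (K : numFieldType) (T : topologicalType)
    (f g : T -> K^o) (x : T) : {for x, continuous f} -> {for x, continuous g} ->
  {for x, continuous (fun y => f y * g y : K^o)}.
Proof. by move=> cf cg; exact: cvgM cf cg. Qed.

Lemma is_derive_directional (K : numFieldType) (V W : normedModType K)
    (u : V -> W) (x v : V) (d : W) :
  is_derive (0 : K) 1 (fun s : K => u (s *: v + x)) d <-> is_derive x v u d.
Proof.
have dE : 'D_1 (fun s : K => u (s *: v + x)) 0 = 'D_v u x.
  rewrite /derive; set g1 := fun h => h^-1 *: _; set g2 := fun h => h^-1 *: _.
  suff -> : g1 = g2 by [].
  apply/funext => h; rewrite /g1 /g2 /=.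
  by rewrite addr0 scale0r add0r [_%:A]mulr1.
split=> -[D E].
  by have D' := iffRL (derivable1P u x v) D; split; rewrite ?dE in E *.
by have D' := iffLR (derivable1P u x v) D; split; rewrite ?dE.
Qed.

Lemma is_derive_horner (K : numFieldType) (p : {poly K}) (z : K^o) :
  is_derive z (1 : K^o) (horner p : K^o -> K^o) (p^`().[z] : K^o).
Proof.
elim/poly_ind: p => [|p c ih].
  rewrite deriv0 horner0.
  have -> : (horner (0 : {poly K}) : K^o -> K^o) = (fun=> 0).
    by apply/funext => y; rewrite horner0.
  exact: is_derive_cst.
have -> : (horner (p * 'X + c%:P) : K^o -> K^o) = (fun y => horner p y * y + c).
  by apply/funext => y; rewrite hornerMXaddC.
have h := is_deriveD (is_deriveM ih (is_derive_id z (1 : K^o)))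
  (is_derive_cst (c : K^o) z (1 : K^o)).
apply: (is_derive_eq h).
rewrite derivD derivC derivM derivX mulr1 addr0 addr0 hornerD hornerMX.
by rewrite /GRing.scale /= mulr1 addrC (mulrC z).
Qed.

Section Separated.
Variable R : realType.
Local Notation V := 'rV[R]_(2 + 1).

Lemma holomorphic_has_derive (f : R[i] -> R[i]) : holomorphic f ->
  exists2 f' : R[i] -> R[i], holomorphic f' &
    forall z, is_derive (z : R[i]^o) (1 : R[i]^o) (f : R[i]^o -> R[i]^o) (f' z).
Proof.
move=> fh; exists (fun z => 'D_1 (f : R[i]^o -> R[i]^o) z).
  exact: holomorphic_of_derive fh _.
by move=> z; apply: derivableP; exact: fh.
Qed.

Lemma conjc_continuous : continuous (@conjc R : R[i]^o -> R[i]^o).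
Proof.
move=> z; apply: continuous_at_dist_le => e e0; apply/nbhs_ballP.
exists e => // w; rewrite /ball /= => /ltW; apply: le_trans.
by rewrite -rmorphB normcJ.
Qed.

Lemma zcoordE (x : V) : zcoord x = (x 0 0)%:C + (x 0 1)%:C * 'i.
Proof.
rewrite /zcoord !mxE; have -> : lshift 1 (0 : 'I_2) = 0 by exact: val_inj.
have -> : lshift 1 (1 : 'I_2) = 1 by exact: val_inj.
by apply/eqP; rewrite eq_complex /=; apply/andP; split; apply/eqP; ring.
Qed.

Lemma tcoordE (x : V) : tcoord x = x 0 (rshift 2 0).
Proof. by rewrite /tcoord mxE. Qed.

Lemma zcoord_line (s : R) (v x : V) :
  zcoord (s *: v + x) = zcoord x + s%:C * zcoord v.
Proof. by rewrite !zcoordE !mxE !rmorphD !rmorphM /=; ring. Qed.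

Lemma tcoord_line (s : R) (v x : V) :
  tcoord (s *: v + x) = tcoord x + s * tcoord v.
Proof. by rewrite !tcoordE !mxE addrC. Qed.

Lemma zcoord_continuous : continuous (@zcoord R : V -> R[i]^o).
Proof.
have -> : (@zcoord R : V -> R[i]^o) = (fun x => (x 0 0)%:C + (x 0 1)%:C * 'i).
  by apply/funext => x; exact: zcoordE.
have c j : continuous (fun x : V => (x 0 j)%:C : R[i]^o).
  move=> x; apply: (@continuous_comp V R R[i]^o (fun x : V => x 0 j)).
    exact: coord_continuous.
  exact: real_complex_continuous.
move=> x; apply: (@continuous_at_add R[i] V (fun x : V => (x 0 0)%:C)
  (fun x : V => (x 0 1)%:C * 'i)); first exact: (c 0 x).
apply: (@continuous_at_mul R[i] V (fun x : V => (x 0 1)%:C) (fun=> 'i)).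
  exact: (c 1 x).
exact: (@cst_continuous V R[i]^o).
Qed.

Lemma tcoord_continuous : continuous (fun x : V => (tcoord x)%:C : R[i]^o).
Proof.
have -> : (fun x : V => (tcoord x)%:C : R[i]^o) =
    (fun x => (x 0 (rshift 2 0))%:C).
  by apply/funext => x; rewrite tcoordE.
move=> x; apply: (@continuous_comp V R R[i]^o (fun x : V => x 0 (rshift 2 0))).
  exact: coord_continuous.
exact: real_complex_continuous.
Qed.

Definition separated (f g : R[i] -> R[i]) (p : {poly R[i]}) (x : V) : R[i] :=
  (f (zcoord x) + g (conjc (zcoord x))) * p.[(tcoord x)%:C].

Lemma separated_continuous (f g : R[i] -> R[i]) p :
  holomorphic f -> holomorphic g ->
  continuous (separated f g p : V -> R[i]^o).
Proof.
move=> fh gh x.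
have hol_comp (h : R[i] -> R[i]) (k : V -> R[i]^o) :
    (forall z, derivable (h : R[i]^o -> R[i]^o) z 1) -> continuous k ->
    {for x, continuous (fun y => h (k y) : R[i]^o)}.
  move=> hh ck; apply: (@continuous_comp V R[i]^o R[i]^o k h); first exact: ck.
  exact: derivable_continuous.
apply: (@continuous_at_mul R[i] V
  (fun x => f (zcoord x) + g (conjc (zcoord x))) (fun x => p.[(tcoord x)%:C])).
  apply: (@continuous_at_add R[i] V
    (fun x => f (zcoord x)) (fun x => g (conjc (zcoord x)))).
  - exact: hol_comp fh zcoord_continuous.
  - apply: (hol_comp _ _ gh) => y.
    apply: (@continuous_comp V R[i]^o R[i]^o (@zcoord R) (@conjc R)).
      exact: zcoord_continuous.
    exact: conjc_continuous.
apply: hol_comp tcoord_continuous => z.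
by have [] := is_derive_horner p z.
Qed.

Definition is_cpartial (F : V -> R[i]) (i : 'I_(2 + 1)) (F' : V -> R[i]) : Prop :=
  forall x, is_derive x (delta_mx 0 i : V) (fun y => complex.Re (F y)) (complex.Re (F' x)) /\
            is_derive x (delta_mx 0 i : V) (fun y => complex.Im (F y)) (complex.Im (F' x)).

Lemma is_cpartial_curve (F F' : V -> R[i]) i :
  (forall x, is_curve_deriv (fun s => F (s *: delta_mx 0 i + x)) 0 (F' x)) ->
  is_cpartial F i F'.
Proof.
by move=> H x; have [h1 h2] := H x; split; apply/is_derive_directional.
Qed.

Section Holomorphic.
Variables (f g f' g' : R[i] -> R[i]) (p : {poly R[i]}).
Hypothesis f'E : forall z,
  is_derive (z : R[i]^o) (1 : R[i]^o) (f : R[i]^o -> R[i]^o) (f' z).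
Hypothesis g'E : forall z,
  is_derive (z : R[i]^o) (1 : R[i]^o) (g : R[i]^o -> R[i]^o) (g' z).

(** Along a line in direction [v], the conjugate of [zcoord] also traces a line, in the conjugate
    direction. The complex chain rule therefore applies to [g] without differentiating the
    conjugation. *)
Lemma separated_curve_z (v x : V) : tcoord v = 0 ->
  is_curve_deriv (fun s => separated f g p (s *: v + x)) 0
    ((f' (zcoord x) * zcoord v + g' (conjc (zcoord x)) * conjc (zcoord v)) *
     p.[(tcoord x)%:C]).
Proof.
move=> v0.
have -> : (fun s => separated f g p (s *: v + x)) =
    (fun s => p.[(tcoord x)%:C] * (f (zcoord x + s%:C * zcoord v) +
              g (conjc (zcoord x) + s%:C * conjc (zcoord v)))).
  apply/funext => s; rewrite /separated zcoord_line tcoord_line v0 mulr0 addr0.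
  rewrite mulrC; congr (_ * (_ + g _)); rewrite rmorphD rmorphM.
  by congr (_ + _ * _); exact: conjc_real.
rewrite mulrC; apply/is_curve_derivZ/is_curve_derivD.
  by apply: is_curve_deriv_comp; rewrite mul0r addr0; exact: f'E.
by apply: is_curve_deriv_comp; rewrite mul0r addr0; exact: g'E.
Qed.

Lemma separated_curve_t (v x : V) : zcoord v = 0 ->
  is_curve_deriv (fun s => separated f g p (s *: v + x)) 0
    ((f (zcoord x) + g (conjc (zcoord x))) *
     (p^`().[(tcoord x)%:C] * (tcoord v)%:C)).
Proof.
move=> v0.
have -> : (fun s => separated f g p (s *: v + x)) =
    (fun s => (f (zcoord x) + g (conjc (zcoord x))) *
              p.[(tcoord x)%:C + s%:C * (tcoord v)%:C]).
  apply/funext => s; rewrite /separated zcoord_line tcoord_line v0 mulr0 addr0.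
  by rewrite rmorphD rmorphM.
apply/is_curve_derivZ/is_curve_deriv_comp.
by rewrite mul0r addr0; exact: is_derive_horner.
Qed.

Lemma separated_partial_x : is_cpartial (separated f g p) 0 (separated f' g' p).
Proof.
apply: is_cpartial_curve => x.
have z1 : zcoord (delta_mx 0 0 : V) = 1.
  by rewrite zcoordE !mxE /= mul0r addr0.
have t0 : tcoord (delta_mx 0 0 : V) = 0 by rewrite tcoordE mxE.
by have := separated_curve_z x t0; rewrite z1 conjc1 !mulr1.
Qed.

(** The factors ['i] and [- 'i] are the derivatives of z and of its conjugate in y. *)
Lemma separated_partial_y : is_cpartial (separated f g p) 1
  (separated (fun z => f' z * 'i) (fun z => g' z * - 'i) p).
Proof.
apply: is_cpartial_curve => x.
have z1 : zcoord (delta_mx 0 1 : V) = 'i.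
  by rewrite zcoordE !mxE /= add0r mul1r.
have t0 : tcoord (delta_mx 0 1 : V) = 0 by rewrite tcoordE mxE.
have := separated_curve_z x t0; rewrite z1.
have -> : conjc 'i = - 'i :> R[i] by apply/eqP; rewrite eq_complex /= oppr0 !eqxx.
exact.
Qed.

Lemma separated_partial_t :
  is_cpartial (separated f g p) (rshift 2 0) (separated f g p^`()).
Proof.
apply: is_cpartial_curve => x.
have z0 : zcoord (delta_mx 0 (rshift 2 0) : V) = 0.
  by rewrite zcoordE !mxE /= mul0r addr0.
have t1 : tcoord (delta_mx 0 (rshift 2 0) : V) = 1 by rewrite tcoordE mxE eqxx.
by have := separated_curve_t x z0; rewrite t1 mulr1.
Qed.

End Holomorphic.

Lemma ord3_cases (i : 'I_(2 + 1)) : [\/ i = 0, i = 1 | i = rshift 2 0].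
Proof.
case: i => -[|[|[|//]]] h; [constructor 1|constructor 2|constructor 3];
  exact: val_inj.
Qed.

Lemma holomorphicZ (f : R[i] -> R[i]) (c : R[i]) :
  holomorphic f -> holomorphic (fun z => f z * c).
Proof.
by move=> fh z; apply: derivableM; [exact: fh | exact: derivable_cst].
Qed.

Lemma separated_partial (f g : R[i] -> R[i]) p i :
  holomorphic f -> holomorphic g -> exists f1 g1 p1,
    [/\ holomorphic f1, holomorphic g1 &
        is_cpartial (separated f g p) i (separated f1 g1 p1)].
Proof.
move=> fh gh; have [f' f'h f'E] := holomorphic_has_derive fh.
have [g' g'h g'E] := holomorphic_has_derive gh.
case: (ord3_cases i) => ->.
- by exists f', g', p; split => //; exact: separated_partial_x.
- exists (fun z => f' z * 'i), (fun z => g' z * - 'i), p.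
  split; [exact: holomorphicZ..|exact: separated_partial_y].
- by exists f, g, p^`(); split => //; exact: separated_partial_t.
Qed.

Lemma separated_csmooth (f g : R[i] -> R[i]) p :
  holomorphic f -> holomorphic g -> csmooth (separated f g p).
Proof.
move=> fh gh.
(* [pr] stands for [Re] or [Im]. By induction on the word [s], each iterated partial derivative is
   [pr] of another separated function, hence continuous and again differentiable. *)
have key (pr : R[i] -> R) (cpr : continuous (pr : R[i]^o -> R))
    (dpr : forall F i F', is_cpartial F i F' -> forall x,
       is_derive x (delta_mx 0 i : V) (fun y => pr (F y)) (pr (F' x))) :
    smooth (fun x => pr (separated f g p x)).
  move=> s; have : exists f1 g1 p1, [/\ holomorphic f1, holomorphic g1 &
      foldr (@partial R _) (fun x => pr (separated f g p x)) s =
      (fun x => pr (separated f1 g1 p1 x))].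
    elim: s => [|i s [f1 [g1 [p1 [h1 h2 E]]]]]; first by exists f, g, p.
    have [f2 [g2 [p2 [k1 k2 hp]]]] := separated_partial p1 i h1 h2.
    exists f2, g2, p2; split => //; rewrite /= E; apply/funext => x.
    exact: (@derive_val _ _ _ _ _ _ _ (dpr _ _ _ hp x)).
  move=> [f1 [g1 [p1 [h1 h2 ->]]]]; split.
    move=> x; apply: (@continuous_comp V R[i]^o R (separated f1 g1 p1) pr).
      exact: separated_continuous.
    exact: cpr.
  move=> i x; have [f2 [g2 [p2 [_ _ hp]]]] := separated_partial p1 i h1 h2.
  by have [] := dpr _ _ _ hp x.
split; apply: key; [exact: Re_continuous|by move=> F i F' H x; have [] := H x|
  exact: Im_continuous|by move=> F i F' H x; have [] := H x].
Qed.

End Separated.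

(** * The Laplacian of the product metric on separated functions *)

Lemma is_deriveMcst (K : numFieldType) (h : K^o -> K^o) (z d c : K^o) :
  is_derive z (1 : K^o) h d ->
  is_derive z (1 : K^o) (fun y => h y * c : K^o) (d * c).
Proof.
move=> H; have dM := is_deriveM H (is_derive_cst c z (1 : K^o)).
by apply: (is_derive_eq dM); rewrite scaler0 add0r /GRing.scale /= mulrC.
Qed.

Section Tau.
Variable R : realType.
Local Notation V := 'rV[R]_(2 + 1).
Local Notation line_ord := (rshift 2 (0 : 'I_1)).

(** The surface block of the metric is this factor times the identity and the line block is 1, so
    the factor is also the square root of the full determinant. *)
Definition conformal (x : V) : R := 4 / (1 + ((lsubmx x) 0 0 ^+ 2 + (lsubmx x) 0 1 ^+ 2)) ^+ 2.

Lemma conformal_gt0 x : 0 < conformal x.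
Proof. by rewrite divr_gt0 // exprn_gt0 // ltr_pwDl // addr_ge0 // sqr_ge0. Qed.

Lemma sphere_lineE x :
  sphere_line_metric x = block_mx (conformal x)%:M 0 0 1%:M.
Proof. by []. Qed.

Lemma sqrt_det_sphere_line x : Num.sqrt (\det (sphere_line_metric x)) = conformal x.
Proof.
rewrite sphere_lineE det_ublock !det_scalar expr1n mulr1 sqrtr_sqr.
by rewrite ger0_norm // ltW // conformal_gt0.
Qed.

Lemma invmx_sphere_line x :
  invmx (sphere_line_metric x) = block_mx (conformal x)^-1%:M 0 0 1%:M.
Proof.
have c0 : conformal x != 0 by rewrite gt_eqF // conformal_gt0.
rewrite sphere_lineE invmx_block_diag; first by rewrite invmx_scalar invmx1.
by rewrite unitmxE det_ublock !det_scalar expr1n mulr1 unitfE expf_neq0.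
Qed.

Lemma conformal_line (s : R) (x : V) :
  conformal (s *: delta_mx 0 line_ord + x) = conformal x.
Proof.
rewrite /conformal !mxE.
have -> (k : 'I_2) : lshift 1 k == line_ord = false by case: k => -[|[|]].
by rewrite !andbF !mulr0 !add0r.
Qed.

Lemma sum_ord3 (F : 'I_(2 + 1) -> R) : \sum_i F i = F 0 + F 1 + F line_ord.
Proof.
rewrite 3!big_ord_recl big_ord0 addr0 addrA; congr (_ + F _ + F _); exact: val_inj.
Qed.

(** In the two surface directions the root of the determinant cancels the inverse metric, leaving
    the plain partial derivatives as flux. In the line direction the factor [conformal] remains but
    does not depend on t, so it passes through the derivative and cancels in front. *)
Lemma laplace_beltrami_sphere_line (u ux uy ut uxx uyy utt : V -> R) :
  (forall x, is_derive x (delta_mx 0 0 : V) u (ux x)) ->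
  (forall x, is_derive x (delta_mx 0 1 : V) u (uy x)) ->
  (forall x, is_derive x (delta_mx 0 line_ord : V) u (ut x)) ->
  (forall x, is_derive x (delta_mx 0 0 : V) ux (uxx x)) ->
  (forall x, is_derive x (delta_mx 0 1 : V) uy (uyy x)) ->
  (forall x, is_derive x (delta_mx 0 line_ord : V) ut (utt x)) ->
  forall x, laplace_beltrami (@sphere_line_metric R) u x =
    (conformal x)^-1 * (uxx x + uyy x) + utt x.
Proof.
move=> hx hy ht hxx hyy htt x.
have c0 y : conformal y != 0 by rewrite gt_eqF // conformal_gt0.
have pE i (w w' : V -> R) : (forall x, is_derive x (delta_mx 0 i : V) w (w' x)) ->
    partial i w = w'.
  by move=> hw; apply/funext => y; exact: (@derive_val _ _ _ _ _ _ _ (hw y)).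
have l0 : (0 : 'I_(2 + 1)) = lshift 1 0 by exact: val_inj.
have l1 : (1 : 'I_(2 + 1)) = lshift 1 1 by exact: val_inj.
rewrite /laplace_beltrami sqrt_det_sphere_line sum_ord3.
have flux i : (fun y => Num.sqrt (\det (sphere_line_metric y)) *
      \sum_(j < 2 + 1) invmx (sphere_line_metric y) i j * partial j u y) =
    (fun y => conformal y * (invmx (sphere_line_metric y) i 0 * ux y +
      invmx (sphere_line_metric y) i 1 * uy y +
      invmx (sphere_line_metric y) i line_ord * ut y)).
  apply/funext => y; rewrite sqrt_det_sphere_line sum_ord3.
  by rewrite (pE _ _ _ hx) (pE _ _ _ hy) (pE _ _ _ ht).
rewrite !flux.
have -> : (fun y => conformal y * (invmx (sphere_line_metric y) 0 0 * ux y +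
    invmx (sphere_line_metric y) 0 1 * uy y +
    invmx (sphere_line_metric y) 0 line_ord * ut y)) = ux.
  apply/funext => y; rewrite invmx_sphere_line l0 l1.
  rewrite !block_mxEul !block_mxEur !mxE /=.
  by rewrite mulr1n mulr0n !mul0r !addr0 mulVKf.
have -> : (fun y => conformal y * (invmx (sphere_line_metric y) 1 0 * ux y +
    invmx (sphere_line_metric y) 1 1 * uy y +
    invmx (sphere_line_metric y) 1 line_ord * ut y)) = uy.
  apply/funext => y; rewrite invmx_sphere_line l0 l1.
  rewrite !block_mxEul !block_mxEur !mxE /=.
  by rewrite mulr1n mulr0n !mul0r addr0 add0r mulVKf.
have -> : (fun y => conformal y * (invmx (sphere_line_metric y) line_ord 0 * ux y +
    invmx (sphere_line_metric y) line_ord 1 * uy y +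
    invmx (sphere_line_metric y) line_ord line_ord * ut y)) =
    (fun y => conformal y * ut y).
  apply/funext => y; rewrite invmx_sphere_line l0 l1.
  rewrite !block_mxEdl !block_mxEdr !mxE /=.
  by rewrite mulr1n !mul0r !add0r mul1r.
rewrite (pE _ _ _ hxx) (pE _ _ _ hyy).
have -> : partial line_ord (fun y => conformal y * ut y) x = conformal x * utt x.
  apply: derive_val; apply/is_derive_directional.
  under eq_fun do rewrite conformal_line.
  have h : is_derive (0 : R) 1 (fun s : R => ut (s *: delta_mx 0 line_ord + x)) (utt x).
    by apply/is_derive_directional.
  exact: is_deriveZ.
by field.
Qed.


Section Separated.
Variables (f g : R[i] -> R[i]).
Hypotheses (f_hol : holomorphic f) (g_hol : holomorphic g).

Lemma tau_separated (p : {poly R[i]}) :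
  tau (@sphere_line_metric R) (separated f g p) = separated f g p^`()^`().
Proof.
have [f' f'h f'E] := holomorphic_has_derive f_hol.
have [g' g'h g'E] := holomorphic_has_derive g_hol.
have [f'' _ f''E] := holomorphic_has_derive f'h.
have [g'' _ g''E] := holomorphic_has_derive g'h.
have scaled (h h' : R[i] -> R[i]) (c : R[i]) :
    (forall z, is_derive (z : R[i]^o) (1 : R[i]^o) (h : R[i]^o -> R[i]^o) (h' z)) ->
    forall z, is_derive (z : R[i]^o) (1 : R[i]^o)
      (fun z => h z * c : R[i]^o) (h' z * c).
  by move=> hh z; exact: is_deriveMcst (hh z).
have px := separated_partial_x p f'E g'E.
have py := separated_partial_y p f'E g'E.
have pt := separated_partial_t f g p.
have pxx := separated_partial_x p f''E g''E.
have pyy := separated_partial_y p (scaled _ _ 'i f''E) (scaled _ _ (- 'i) g''E).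
have ptt := separated_partial_t f g p^`().
(* Harmonicity in the plane: the second y-derivative carries the square of ['i] or of [- 'i], both
   -1, and so cancels the second x-derivative. *)
have sumE x : separated f'' g'' p x +
    separated (fun z => f'' z * 'i * 'i) (fun z => g'' z * - 'i * - 'i) p x = 0.
  have i2 : 'i * 'i = -1 :> R[i] by rewrite -expr2 sqr_i.
  rewrite /separated -!mulrA mulrNN i2; ring.
apply/funext => x; rewrite /tau.
have parts (pr : R[i] -> R) : 
    (forall F i F', is_cpartial F i F' -> forall x,
       is_derive x (delta_mx 0 i : V) (fun y => pr (F y)) (pr (F' x))) ->
    (forall z w, pr (z + w) = pr z + pr w) -> pr 0 = 0 ->
    laplace_beltrami (@sphere_line_metric R) (fun y => pr (separated f g p y)) x =
    pr (separated f g p^`()^`() x).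
  move=> dpr prD pr0.
  rewrite (laplace_beltrami_sphere_line (dpr _ _ _ px) (dpr _ _ _ py)
    (dpr _ _ _ pt) (dpr _ _ _ pxx) (dpr _ _ _ pyy) (dpr _ _ _ ptt)).
  by rewrite -prD sumE pr0 mulr0 add0r.
have -> := parts (@complex.Re R) (fun F i F' H y => (H y).1)
  (raddfD (@complex.Re R)) (erefl _).
have -> := parts (@complex.Im R) (fun F i F' H y => (H y).2)
  (raddfD (@complex.Im R)) (erefl _).
by case: (separated _ _ _ _).
Qed.

Lemma iter_tau_separated (n : nat) (p : {poly R[i]}) :
  iter n (tau (@sphere_line_metric R)) (separated f g p) =
  separated f g p^`(2 * n).
Proof.
elim: n => [|n ih]; first by rewrite muln0 derivn0.
have -> : (2 * n.+1 = (2 * n).+2)%N by lia.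
by rewrite iterS ih tau_separated !derivnS.
Qed.

End Separated.

End Tau.

(** * Non-vanishing of the last iterate, and the conclusion *)

Lemma poly_real_eq0 (R : realType) (q : {poly R[i]}) : (size q <= 2)%N ->
  (forall t : R, q.[t%:C] = 0) -> q = 0.
Proof.
move=> sq hq.
have hE t : q.[t] = q`_0 + q`_1 * t.
  rewrite (horner_coef_wide _ sq) big_ord_recl big_ord1 /=.
  by rewrite expr0 mulr1 expr1.
have h0 := hq 0; rewrite hE mulr0 addr0 in h0.
have h1 := hq 1; rewrite hE h0 add0r mulr1 in h1.
apply/polyP => -[|[|k]]; rewrite coef0 //.
by rewrite nth_default // (leq_trans sq).
Qed.

Theorem lemma6p2 (R : realType) (r : nat) (r_gt0 : (0 < r)%N)
    (f g : R[i] -> R[i]) (f_hol : holomorphic f) (g_hol : holomorphic g)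
    (fg_neq0 : exists z : R[i], f z + g (conjc z) <> 0)
    (b : nat -> R[i]) (P : R -> R[i])
    (P_def : forall t : R, P t = \sum_(k < (2 * r)%N) b k * t%:C ^+ k)
    (b_neq0 : (b (2 * r - 2)%N, b (2 * r - 1)%N) <> (0, 0)) :
  proper_r_harmonic (@sphere_line_metric R) r
    (fun p : 'rV[R]_(2 + 1) =>
       (f (zcoord p) + g (conjc (zcoord p))) * P (tcoord p)).
Proof.
pose p : {poly R[i]} := \poly_(k < (2 * r)%N) b k.
have -> : (fun x : 'rV[R]_(2 + 1) =>
    (f (zcoord x) + g (conjc (zcoord x))) * P (tcoord x)) = separated f g p.
  by apply/funext => x; rewrite /separated horner_poly P_def.
split; first split; first exact: separated_csmooth.
  (* The [r]-th iterate differentiates [p] [2 * r] times, while its degree is below [2 * r]. *)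
  move=> x; rewrite iter_tau_separated // derivn_poly0 ?size_poly //.
  by rewrite /separated horner0 mulr0.
rewrite iter_tau_separated // => vanish.
have [z hz] := fg_neq0.
have [n rE] : exists n, r = n.+1 by exists r.-1; rewrite prednK.
(* After [2 * r - 2] derivatives the degree is at most one. Over the point [z], where the first
   factor is nonzero, the polynomial vanishes at every real [t], and its values at 0 and 1 already
   force it to be 0. *)
have q0 : p^`(2 * r.-1) = 0.
  apply: poly_real_eq0.
    apply/leq_sizeP => j hj; rewrite coef_derivn nth_default ?mul0rn //.
    by apply: leq_trans (size_poly _ _) _; rewrite rE /=; lia.
  move=> t; pose x : 'rV[R]_(2 + 1) :=
    row_mx (\row_j (if j == 0 then complex.Re z else complex.Im z)) (const_mx t).
  have xz : zcoord x = z by rewrite /zcoord row_mxKl !mxE /=; case: (z).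
  have xt : tcoord x = t by rewrite /tcoord row_mxKr mxE.
  have /eqP := vanish x; rewrite /separated xz xt mulf_eq0 => /orP[/eqP //|/eqP //].
(* The [k]-th coefficient of this derivative is [b (2 * r.-1 + k)] times a falling factorial, a
   positive integer; [k = 0] and [k = 1] give the two top coefficients. *)
have coef k : (2 * r.-1 + k < 2 * r)%N -> b (2 * r.-1 + k)%N = 0.
  move=> hk; have : (p^`(2 * r.-1))`_k = 0 by rewrite q0 coef0.
  rewrite coef_derivn coef_poly hk => /eqP.
  by rewrite mulrn_eq0 => /orP[|/eqP //]; rewrite -leqn0 leqNgt ffact_gt0 leq_addr.
apply: b_neq0; have h0 := coef 0%N; have h1 := coef 1%N.
congr (_, _).
- by rewrite -[RHS]h0; [congr b|]; rewrite rE /=; lia.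
- by rewrite -[RHS]h1; [congr b|]; rewrite rE /=; lia.
Qed.
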